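(* $\mathrm{OOO}^{D}{+}\mathrm{CCM} \subseteq \mathrm{WMM\text{-}D}$; that is, for every number of processors $n$, every $n$-processor program and every initial state, every program behavior of the physical multiprocessor model $\mathrm{OOO}^{D}{+}\mathrm{CCM}$ (out-of-order processors without load-value speculation) is also a program behavior of the memory model $\mathrm{WMM\text{-}D}$.
   Context: **Programs and conventions.** There are $n$ processors. Processor $i$ runs a fixed program: $\mathsf{fetch}(pc)$ gives the instruction at $pc$ (never modified). Instructions are: $\mathsf{Nm}$ (non-memory, e.g. ALU/branch: from its source registers and its PC it computes a next PC and a value for a destination register), $\mathsf{Ld}$ (an address is computed from source registers, the loaded value goes to a destination register), $\mathsf{St}$ (address and data are computed from source registers), and the fences $\mathsf{Commit}$ and $\mathsf{Reconcile}$. The next PC of a non-$\mathsf{Nm}$ instruction is determined by its PC alone. Each model is a nondeterministic transition system; a rule may fire atomically whenever its guard holds; an execution is a finite sequence of rule firings from the initial state. All models start with the same registers, PCs and memory values, with all buffers empty. $\epsilon$ means ''not available''. **CCM (write-back cache memory).** State: memory $m$ with $m[a]=\langle v,t\rangle$ (value and tag of the store that wrote it; initial values carry special tags different from the tags of all stores), and for each $i$ an unordered buffer $mrb[i]$. Processor $i$ calls $\mathsf{reqLd}(idx,a)$ or $\mathsf{reqSt}(a,v,t)$, which insert $\langle \mathsf{Ld},idx,a\rangle$ or $\langle\mathsf{St},a,v,t\rangle$ into $mrb[i]$. Rules: *CCM-Ld*: remove any $\langle\mathsf{Ld},idx,a\rangle$ from some $mrb[i]$ and call $\mathsf{respLd}(idx,v,t)$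 of processor $i$, where $\langle v,t\rangle=m[a]$. *CCM-St*: remove any $\langle\mathsf{St},a,v,t\rangle$ from some $mrb[i]$, set $m[a]:=\langle v,t\rangle$, call $\mathsf{respSt}(a)$ of processor $i$. **$\mathrm{OOO}^{D}$ (out-of-order processor without value prediction).** State of each processor: PC register $pcr$, register file $rf$, reorder buffer $rob$, store buffer $sb$ (a list of entries $\langle a,v,t,iss\rangle$ ordered from oldest to youngest), and a bit vector $lf$ (initially all False). $rob$ is a list of unbounded length; each new entry gets an index larger than all indices ever used (younger = larger index; indices are never reused). An entry is $\langle pc,npc,ins,ex\rangle$ with $npc$ the (predicted) next PC and $ex\in\{\mathsf{Idle},\mathsf{Exe},\mathsf{ReEx},\mathsf{Done}\}$. The field $ins$ is $\langle\mathsf{Nm},op,srcs,dst,val\rangle$, or $\langle\mathsf{Ld},srcs,dst,a,v,t\rangle$ ($t$ = tag of the store read), or $\langle\mathsf{St},srcs,a,v,t\rangle$ ($t$ = globally unique tag assigned at fetch), or $\langle\mathsf{Commit}\rangle$, or $\langle\mathsf{Reconcile}\rangle$; the fields $val,a,v$ and the tag of a load are initially $\epsilon$. A source register of an entry is ready if the youngest older $rob$ entry writing that register has a non-$\epsilon$ value, or if no older entry writes it (then $rf$ is used); an entry is ready if all its source registers are. The commit slot is the oldest entry. Auxiliary operations. $\mathsf{flush}(idx,pc)$: delete all entries with index $\ge idx$, set $pcr:=pc$, and for each deleted $\mathsf{Ld}$ with $ex\in\{\mathsf{Exe},\mathsf{ReEx}\}$ set its $lf$ bit to True. $\mathsf{findBypass}(idx,a)$: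 search $rob$ from the entry just older than $idx$ to the oldest, then $sb$ from youngest to oldest; return $\langle v,t\rangle$ of the first executed store to $a$ found; return $\epsilon$ if a $\mathsf{Reconcile}$ is met first; return $\top$ if nothing is found. $\mathsf{findAffectedLd}(idx,a)$: search from index $idx+1$ to the youngest entry, stopping at the first $\mathsf{St}$ with computed address $a$; return the list (oldest first) of all $\mathsf{Ld}$ entries met with address $a$ and $ex\ne\mathsf{Idle}$. $\mathsf{findStaleLd}(idx,a,t)$: search from $idx+1$ to the youngest entry for the first $\mathsf{Ld}$ with address $a$, $ex=\mathsf{Done}$ and tag $t'\neq t$ and return its index; return $\top$ if there is none or if a $\mathsf{St}$ with computed address $a$ is met first. Rules: - *OOO-Fetch*: $ins=\mathsf{fetch}(pcr)$; choose a prediction $npc$ (arbitrary for $\mathsf{Nm}$, the correct next PC otherwise); append $\langle pcr,npc,ins,ex\rangle$ with $ex=\mathsf{Done}$ for fences and $\mathsf{Idle}$ otherwise; $pcr:=npc$. - *OOO-NmEx*: for a ready $\mathsf{Idle}$ $\mathsf{Nm}$ entry $idx$, compute $\langle nextpc,val\rangle$, store $val$, set the entry's next-PC field to $nextpc$ and $ex:=\mathsf{Done}$; if $nextpc$ differs from the old $npc$ then $\mathsf{flush}(idx+1,nextpc)$. - *OOO-LdAddr*: for a ready $\mathsf{Idle}$ $\mathsf{Ld}$ with address $\epsilon$, compute and record its address. - *OOO-LdBypass*: for a ready $\mathsf{Idle}$ $\mathsf{Ld}$ at $idx$ with computed address $a$, if $\mathsf{findBypass}(idx,a)=\langle res,t\rangle$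 (neither $\epsilon$ nor $\top$): set value $res$, tag $t$, $ex:=\mathsf{Done}$. - *OOO-LdReq*: for a ready $\mathsf{Idle}$ $\mathsf{Ld}$ at $idx$ with computed address $a$, if $\mathsf{findBypass}(idx,a)=\top$ and $\neg lf[idx]$: call $\mathsf{reqLd}(idx,a)$ and set $ex:=\mathsf{Exe}$. - *OOO-StEx*: for a ready $\mathsf{Idle}$ $\mathsf{St}$ at $idx$, compute address $a$ and data $v$, let $list=\mathsf{findAffectedLd}(idx,a)$, record $a,v$, set $ex:=\mathsf{Done}$; then for each $k$ in $list$ from oldest to youngest: if $rob[k].ex=\mathsf{Done}$ then $\mathsf{flush}(k,rob[k].pc)$ and stop, else $rob[k].ex:=\mathsf{ReEx}$. - *OOO-NmLdRecCom*: if the commit slot is a $\mathsf{Done}$ $\mathsf{Nm}$, $\mathsf{Ld}$ or $\mathsf{Reconcile}$, remove it and update $rf$ with its result. - *OOO-StCom*: if the commit slot is a $\mathsf{Done}$ $\mathsf{St}$, remove it and append $\langle a,v,t,\mathrm{False}\rangle$ to $sb$. - *OOO-ComCom*: if the commit slot is $\mathsf{Commit}$ and $sb$ is empty, remove it. - *OOO-StReq*: for some address $a$ in $sb$ whose oldest store has $iss=$ False, call $\mathsf{reqSt}(a,v,t)$ for that store and set its $iss$ to True. Methods called by the memory: $\mathsf{respSt}(a)$ deletes the oldest store to $a$ from $sb$. $\mathsf{respLd}(idx,res,t)$: if $lf[idx]$, set $lf[idx]:=$ False; else, for the $\mathsf{Ld}$ entry at $idx$ (address $a$): if $ex=\mathsf{ReEx}$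 set $ex:=\mathsf{Idle}$; otherwise record value $res$, tag $t$, $ex:=\mathsf{Done}$, let $k=\mathsf{findStaleLd}(idx,a,t)$, and if $k\ne\top$ do $\mathsf{flush}(k,rob[k].pc)$. $\mathrm{OOO}^{D}{+}\mathrm{CCM}$ is $n$ such processors connected to the $n$ ports of one CCM. **WMM-D.** State: a global clock $gts$ (initially 0); monolithic memory with $m[a]=\langle v,\langle i,sts\rangle,mts\rangle$ ($v$ the value, $i$ the processor that wrote it, $sts$ the creation timestamp of the store, $mts$ the timestamp of the memory value; initially the initial value with no writer and $sts=mts=0$); and for each processor $i$: register state (including PC) with a timestamp (initially 0) on every register other than PC, a timestamp $rts_i$ (initially 0), a store buffer $sb_i$ (list of $\langle a,v,sts\rangle$, oldest to youngest), and an invalidation buffer $ib_i$ of entries $\langle a,v,[ts_L,ts_U]\rangle$. Instructions execute instantaneously in program order; executing one updates registers and PC. For the next instruction let $ats$ be the maximum timestamp of its source registers, excluding PC (0 if none). Rules for processor $i$: - $\mathsf{Nm}$: execute; the destination register gets timestamp $ats$. - $\mathsf{Ld}\ a$, if $sb_i$ contains $a$: with $\langle v,sts\rangle$ the youngest for $a$ in $sb_i$, return $v$ with destination timestamp $\max(ats,rts_i,sts)$. - $\mathsf{Ld}\ a$, if $sb_i$ does not contain $a$: with $m[a]=\langle v,\langle j,sts\rangle,mts\rangle$ and $vts=mts$ if $i\ne j$, $vts=sts$ if $i=j$, return $v$ with destination timestamp $\max(ats,rts_i,vts)$; remove all entries for $a$ from $ib_i$. - $\mathsf{Ld}\ a$,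 if $sb_i$ does not contain $a$: choose any entry $\langle a,v,[ts_L,ts_U]\rangle$ of $ib_i$ with $ats\le ts_U$; return $v$ with destination timestamp $\max(ats,rts_i,ts_L)$; remove from $ib_i$ all entries for $a$ that were inserted when $gts<ts_U$. - $\mathsf{St}\ a\ v$: append $\langle a,v,ats\rangle$ to $sb_i$ and remove all entries for $a$ from $ib_i$. - $\mathsf{Reconcile}$: execute, empty $ib_i$, set $rts_i:=gts$. - $\mathsf{Commit}$: executes only if $sb_i$ is empty. - Background rule (dequeue): for some $a$ in $sb_i$, let $m[a]=\langle v',\langle i',sts'\rangle,mts\rangle$ and $ts_U=gts$; remove the oldest $\langle v,sts\rangle$ for $a$ from $sb_i$; set $m[a]:=\langle v,\langle i,sts\rangle,gts+1\rangle$ and $gts:=gts+1$; for every $j\neq i$ such that $sb_j$ does not contain $a$, insert $\langle a,v',[ts_L,ts_U]\rangle$ into $ib_j$, where $ts_L=mts$ if $j\ne i'$ and $ts_L=sts'$ if $j=i'$. **Program behavior.** Consider any finite execution at whose end all store buffers are empty. Its behavior consists of: for each processor, the sequence of instructions committed from $rob$ (in WMM-D: executed), with their results ($\mathsf{Nm}$ values and next PCs, store addresses and data, load addresses and loaded values), and the final values in the monolithic memory. $A\subseteq B$ means that every behavior of $A$ is a behavior of $B$, for the same program and initial state. *)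

(* Defs.v *)
From mathcomp Require Import all_boot.

Set Implicit Arguments.
Unset Strict Implicit.
Unset Printing Implicit Defensive.

Definition upd (A : eqType) (B : Type) (f : A -> B) (x : A) (y : B) : A -> B :=
  fun z => if z == x then y else f z.

Definition rem_first (T : Type) (p : pred T) (s : seq T) : seq T :=
  take (find p s) s ++ drop (find p s).+1 s.

(* [exec step s0 tr s]: a finite sequence of rule firings leads from s0 to s;
   tr collects, in order, what the firings emit (None: nothing emitted). *)
Inductive exec (S L : Type) (step : S -> option L -> S -> Prop) (s0 : S) :
    seq L -> S -> Prop :=
| ExecNil : exec step s0 [::] s0
| ExecStep tr s l s' :
    exec step s0 tr s -> step s l s' -> exec step s0 (tr ++ seq_of_opt l) s'.

Section Models.

Context (Reg Addr PC : eqType) (Val : Type) (n : nat).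

(* The functions carried by an instruction receive the values of its source
   registers, in the order of [srcs]. *)
Inductive instr :=
| Nm (op : PC -> seq Val -> PC * Val) (srcs : seq Reg) (dst : Reg)
| Ld (fa : seq Val -> Addr) (srcs : seq Reg) (dst : Reg)
| St (fa : seq Val -> Addr) (fd : seq Val -> Val) (srcs : seq Reg)
| Commit
| Reconcile.

Definition is_nm (x : instr) := if x is Nm _ _ _ then true else false.
Definition is_ld (x : instr) := if x is Ld _ _ _ then true else false.

Definition dst_of (x : instr) : option Reg :=
  match x with
  | Nm _ _ d | Ld _ _ d => Some d
  | _ => None
  end.

(* [seqpc pc]: the next PC of a non-Nm instruction located at pc. *)
Record program := Program { fetch : PC -> instr; seqpc : PC -> PC }.

Record init_state := InitState {
  init_pc : 'I_n -> PC;
  init_rf : 'I_n -> Reg -> Val;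
  init_mem : Addr -> Val }.

Inductive result :=
| ResNm (v : Val) (npc : PC)
| ResLd (a : Addr) (v : Val)
| ResSt (a : Addr) (v : Val)
| ResFence.

Record event := Event { ev_pc : PC; ev_ins : instr; ev_res : result }.

Record behavior := Behavior {
  beh_log : 'I_n -> seq event;
  beh_mem : Addr -> Val }.

Definition is_behavior (S : Type)
    (step : S -> option ('I_n * event) -> S -> Prop) (s0 : S)
    (sbs_empty : S -> Prop) (memval : S -> Addr -> Val) (b : behavior) : Prop :=
  exists tr s,
    [/\ exec step s0 tr s,
        sbs_empty s,
        forall i, beh_log b i = [seq x.2 | x <- tr & x.1 == i]
      & forall a, beh_mem b a = memval s a].

(* [inl a] is the tag of the initial value of a.  [inr (i, k)] is the tag of
   the store of processor i fetched into the reorder buffer at index k; as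
   indices are never reused, it is globally unique. *)
Definition tag : eqType := (Addr + 'I_n * nat)%type.

Inductive exstate := Idle | Exe | ReEx | Done.

Definition is_idle (x : exstate) := if x is Idle then true else false.
Definition is_done (x : exstate) := if x is Done then true else false.
Definition in_flight (x : exstate) :=
  match x with Exe | ReEx => true | _ => false end.

(* The run-time fields are shared by all kinds of instructions: [e_val] is the
   value of an Nm, the loaded value of a Ld or the data of a St; [e_addr] and
   [e_tag] are only used by Ld and St.  None stands for epsilon. *)
Record entry := Entry {
  e_idx : nat;
  e_pc : PC;
  e_npc : PC;
  e_ins : instr;
  e_ex : exstate;
  e_addr : option Addr;
  e_val : option Val;
  e_tag : option tag }.

Definition new_entry (i : 'I_n) (k : nat) (pc npc : PC) (x : instr) : entry :=
  Entry k pc npc x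
    (match x with Commit | Reconcile => Done | _ => Idle end)
    None None
    (if x is St _ _ _ then Some (inr (i, k)) else None).

Definition set_ex (x : exstate) (e : entry) : entry :=
  Entry (e_idx e) (e_pc e) (e_npc e) (e_ins e) x (e_addr e) (e_val e) (e_tag e).

Definition set_addr (a : Addr) (e : entry) : entry :=
  Entry (e_idx e) (e_pc e) (e_npc e) (e_ins e) (e_ex e)
    (Some a) (e_val e) (e_tag e).

Definition nm_done (npc : PC) (v : Val) (e : entry) : entry :=
  Entry (e_idx e) (e_pc e) npc (e_ins e) Done (e_addr e) (Some v) (e_tag e).

Definition ld_done (v : Val) (t : tag) (e : entry) : entry :=
  Entry (e_idx e) (e_pc e) (e_npc e) (e_ins e) Done (e_addr e) (Some v) (Some t).

Definition st_done (a : Addr) (v : Val) (e : entry) : entry :=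
  Entry (e_idx e) (e_pc e) (e_npc e) (e_ins e) Done (Some a) (Some v) (e_tag e).

Record sb_entry := SbEntry {
  s_addr : Addr;
  s_val : Val;
  s_tag : tag;
  s_iss : bool }.

(* [rob] and [sb] are listed from oldest to youngest.  All the indices used so
   far are smaller than [idx_bound]. *)
Record proc := Proc {
  pcr : PC;
  rf : Reg -> Val;
  rob : seq entry;
  sb : seq sb_entry;
  lf : nat -> bool;
  idx_bound : nat }.

Definition set_rob (p : proc) (es : seq entry) : proc :=
  Proc (pcr p) (rf p) es (sb p) (lf p) (idx_bound p).

Definition set_sb (p : proc) (q : seq sb_entry) : proc :=
  Proc (pcr p) (rf p) (rob p) q (lf p) (idx_bound p).

Definition lookup (p : proc) (k : nat) : option entry :=
  ohead [seq e <- rob p | e_idx e == k].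

Definition modify (p : proc) (k : nat) (f : entry -> entry) : proc :=
  set_rob p [seq if e_idx e == k then f e else e | e <- rob p].

Definition older (p : proc) (k : nat) := [seq e <- rob p | e_idx e < k].
Definition younger (p : proc) (k : nat) := [seq e <- rob p | k < e_idx e].

(* Value of register r seen by the entry at index k: None if not ready.  The
   last update of the fold is the one of the youngest older writer of r. *)
Definition src_val (p : proc) (k : nat) (r : Reg) : option Val :=
  foldl (fun acc e => if dst_of (e_ins e) == Some r then e_val e else acc)
        (Some (rf p r)) (older p k).

(* Source values of the entry at index k, provided that all are ready. *)
Definition src_vals (p : proc) (k : nat) (srcs : seq Reg) : option (seq Val) :=
  if all (fun r => isSome (src_val p k r)) srcs
  then Some (pmap (src_val p k) srcs) else None.

Definition flush (p : proc) (k : nat) (pc : PC) : proc :=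
  Proc pc (rf p)
    [seq e <- rob p | e_idx e < k]
    (sb p)
    (fun j => has (fun e => [&& e_idx e == j, k <= e_idx e,
                               is_ld (e_ins e) & in_flight (e_ex e)]) (rob p)
              || lf p j)
    (idx_bound p).

Inductive bypass_result := BypassEps | BypassTop | BypassHit (v : Val) (t : tag).

Fixpoint bypass_sb (a : Addr) (q : seq sb_entry) : bypass_result :=
  if q is s :: q' then
    if s_addr s == a then BypassHit (s_val s) (s_tag s) else bypass_sb a q'
  else BypassTop.

(* Searches es, then the store buffer q; both are given youngest first.  A St
   is executed exactly when its address and data are available. *)
Fixpoint bypass_rob (a : Addr) (es : seq entry) (q : seq sb_entry) :
    bypass_result :=
  if es is e :: es' then
    match e_ins e, e_addr e, e_val e, e_tag e with
    | Reconcile, _, _, _ => BypassEps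
    | St _ _ _, Some a', Some v, Some t =>
        if a' == a then BypassHit v t else bypass_rob a es' q
    | _, _, _, _ => bypass_rob a es' q
    end
  else bypass_sb a q.

Definition find_bypass (p : proc) (k : nat) (a : Addr) : bypass_result :=
  bypass_rob a (rev (older p k)) (rev (sb p)).

Fixpoint affected_lds (a : Addr) (es : seq entry) : seq nat :=
  if es is e :: es' then
    match e_ins e with
    | St _ _ _ => if e_addr e == Some a then [::] else affected_lds a es'
    | Ld _ _ _ =>
        if (e_addr e == Some a) && ~~ is_idle (e_ex e)
        then e_idx e :: affected_lds a es' else affected_lds a es'
    | _ => affected_lds a es'
    end
  else [::].

Definition find_affected_ld (p : proc) (k : nat) (a : Addr) : seq nat :=
  affected_lds a (younger p k).

(* None stands for top. *)
Fixpoint stale_ld (a : Addr) (t : tag) (es : seq entry) : option nat :=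
  if es is e :: es' then
    match e_ins e with
    | St _ _ _ => if e_addr e == Some a then None else stale_ld a t es'
    | Ld _ _ _ =>
        if [&& e_addr e == Some a, is_done (e_ex e) & e_tag e != Some t]
        then Some (e_idx e) else stale_ld a t es'
    | _ => stale_ld a t es'
    end
  else None.

Definition find_stale_ld (p : proc) (k : nat) (a : Addr) (t : tag) : option nat :=
  stale_ld a t (younger p k).

Definition flush_at (p : proc) (k : nat) : proc :=
  if lookup p k is Some e then flush p k (e_pc e) else p.

(* The loop of OOO-StEx over the affected loads. *)
Fixpoint kill_lds (p : proc) (ks : seq nat) : proc :=
  if ks is k :: ks' then
    if lookup p k is Some e then
      if is_done (e_ex e) then flush p k (e_pc e)
      else kill_lds (modify p k (set_ex ReEx)) ks'
    else p
  else p.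

Inductive request :=
| ReqLd (k : nat) (a : Addr)
| ReqSt (a : Addr) (v : Val) (t : tag).

(* What a rule of a processor does outside its own state: nothing, a call to
   the memory, or the retirement of an instruction. *)
Inductive action := Silent | Call (r : request) | Retire (x : event).

Inductive ooo_rule (i : 'I_n) (P : program) : proc -> action -> proc -> Prop :=
| OooFetch p k npc :
    idx_bound p <= k ->
    (~~ is_nm (fetch P (pcr p)) -> npc = seqpc P (pcr p)) ->
    ooo_rule i P p Silent
      (Proc npc (rf p)
         (rcons (rob p) (new_entry i k (pcr p) npc (fetch P (pcr p))))
         (sb p) (lf p) k.+1)
| OooNmEx p k e op srcs dst vs npc v :
    lookup p k = Some e -> e_ins e = Nm op srcs dst -> e_ex e = Idle ->
    src_vals p k srcs = Some vs ->
    op (e_pc e) vs = (npc, v) ->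
    let p' := modify p k (nm_done npc v) in
    ooo_rule i P p Silent
      (if npc == e_npc e then p' else flush p' k.+1 npc)
| OooLdAddr p k e fa srcs dst vs :
    lookup p k = Some e -> e_ins e = Ld fa srcs dst -> e_ex e = Idle ->
    src_vals p k srcs = Some vs ->
    e_addr e = None ->
    ooo_rule i P p Silent (modify p k (set_addr (fa vs)))
| OooLdBypass p k e fa srcs dst vs a v t :
    lookup p k = Some e -> e_ins e = Ld fa srcs dst -> e_ex e = Idle ->
    src_vals p k srcs = Some vs ->
    e_addr e = Some a ->
    find_bypass p k a = BypassHit v t ->
    ooo_rule i P p Silent (modify p k (ld_done v t))
| OooLdReq p k e fa srcs dst vs a :
    lookup p k = Some e -> e_ins e = Ld fa srcs dst -> e_ex e = Idle ->
    src_vals p k srcs = Some vs ->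
    e_addr e = Some a ->
    find_bypass p k a = BypassTop ->
    ~~ lf p k ->
    ooo_rule i P p (Call (ReqLd k a)) (modify p k (set_ex Exe))
| OooStEx p k e fa fd srcs vs :
    lookup p k = Some e -> e_ins e = St fa fd srcs -> e_ex e = Idle ->
    src_vals p k srcs = Some vs ->
    let ks := find_affected_ld p k (fa vs) in
    ooo_rule i P p Silent (kill_lds (modify p k (st_done (fa vs) (fd vs))) ks)
| OooNmCom p e es op srcs dst v :
    rob p = e :: es -> e_ex e = Done ->
    e_ins e = Nm op srcs dst -> e_val e = Some v ->
    ooo_rule i P p (Retire (Event (e_pc e) (e_ins e) (ResNm v (e_npc e))))
      (Proc (pcr p) (upd (rf p) dst v) es (sb p) (lf p) (idx_bound p))
| OooLdCom p e es fa srcs dst a v :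
    rob p = e :: es -> e_ex e = Done ->
    e_ins e = Ld fa srcs dst -> e_addr e = Some a -> e_val e = Some v ->
    ooo_rule i P p (Retire (Event (e_pc e) (e_ins e) (ResLd a v)))
      (Proc (pcr p) (upd (rf p) dst v) es (sb p) (lf p) (idx_bound p))
| OooRecCom p e es :
    rob p = e :: es -> e_ex e = Done ->
    e_ins e = Reconcile ->
    ooo_rule i P p (Retire (Event (e_pc e) (e_ins e) ResFence)) (set_rob p es)
| OooStCom p e es fa fd srcs a v t :
    rob p = e :: es -> e_ex e = Done ->
    e_ins e = St fa fd srcs ->
    e_addr e = Some a -> e_val e = Some v -> e_tag e = Some t ->
    ooo_rule i P p (Retire (Event (e_pc e) (e_ins e) (ResSt a v)))
      (set_sb (set_rob p es) (rcons (sb p) (SbEntry a v t false)))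
| OooComCom p e es :
    rob p = e :: es ->
    e_ins e = Commit ->
    sb p = [::] ->
    ooo_rule i P p (Retire (Event (e_pc e) (e_ins e) ResFence)) (set_rob p es)
| OooStReq p q1 a v t q2 :
    sb p = q1 ++ SbEntry a v t false :: q2 ->
    ~~ has (fun s => s_addr s == a) q1 ->
    ooo_rule i P p (Call (ReqSt a v t))
      (set_sb p (q1 ++ SbEntry a v t true :: q2)).

Definition resp_st (p : proc) (a : Addr) : proc :=
  set_sb p (rem_first (fun s => s_addr s == a) (sb p)).

(* The branches returning p unchanged for want of an entry or of an address are
   never reached: a load in flight is in [rob] unless its [lf] bit is set. *)
Definition resp_ld (p : proc) (k : nat) (v : Val) (t : tag) : proc :=
  if lf p k then
    Proc (pcr p) (rf p) (rob p) (sb p) (upd (lf p) k false) (idx_bound p)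
  else if lookup p k is Some e then
    if e_ex e is ReEx then modify p k (set_ex Idle)
    else if e_addr e is Some a then
      let p' := modify p k (ld_done v t) in
      if find_stale_ld p' k a t is Some k' then flush_at p' k' else p'
    else p
  else p.

(* The lists [o_mrb] stand for unordered buffers: any element can be removed. *)
Record ooo_state := OooState {
  o_proc : 'I_n -> proc;
  o_mrb : 'I_n -> seq request;
  o_mem : Addr -> Val * tag }.

Inductive ooo_step (prog : 'I_n -> program) :
    ooo_state -> option ('I_n * event) -> ooo_state -> Prop :=
| StepSilent s i p' :
    ooo_rule i (prog i) (o_proc s i) Silent p' ->
    ooo_step prog s None
      (OooState (upd (o_proc s) i p') (o_mrb s) (o_mem s))
| StepCall s i r p' :
    ooo_rule i (prog i) (o_proc s i) (Call r) p' ->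
    ooo_step prog s None
      (OooState (upd (o_proc s) i p')
         (upd (o_mrb s) i (rcons (o_mrb s i) r)) (o_mem s))
| StepRetire s i x p' :
    ooo_rule i (prog i) (o_proc s i) (Retire x) p' ->
    ooo_step prog s (Some (i, x))
      (OooState (upd (o_proc s) i p') (o_mrb s) (o_mem s))
| StepCcmLd s i q1 k a q2 v t :
    o_mrb s i = q1 ++ ReqLd k a :: q2 ->
    o_mem s a = (v, t) ->
    ooo_step prog s None
      (OooState (upd (o_proc s) i (resp_ld (o_proc s i) k v t))
         (upd (o_mrb s) i (q1 ++ q2)) (o_mem s))
| StepCcmSt s i q1 a v t q2 :
    o_mrb s i = q1 ++ ReqSt a v t :: q2 ->
    ooo_step prog s None
      (OooState (upd (o_proc s) i (resp_st (o_proc s i) a))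
         (upd (o_mrb s) i (q1 ++ q2)) (upd (o_mem s) a (v, t))).

Definition ooo_init (s0 : init_state) : ooo_state :=
  OooState
    (fun i => Proc (init_pc s0 i) (init_rf s0 i) [::] [::] (fun=> false) 0)
    (fun=> [::])
    (fun a => (init_mem s0 a, inl a)).

Definition ooo_ccm_behavior (prog : 'I_n -> program) (s0 : init_state) :
    behavior -> Prop :=
  is_behavior (ooo_step prog) (ooo_init s0)
    (fun s => forall i, sb (o_proc s i) = [::])
    (fun s a => (o_mem s a).1).

Record wmem_cell := WCell {
  c_val : Val;
  c_writer : option 'I_n;
  c_sts : nat;
  c_mts : nat }.

Record wsb_entry := WSb { ws_addr : Addr; ws_val : Val; ws_sts : nat }.

Record ib_entry := Ib {
  ib_addr : Addr;
  ib_val : Val;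
  ib_tsL : nat;
  ib_tsU : nat }.

(* [w_sb] is listed from oldest to youngest; the order in [w_ib] is
   irrelevant. *)
Record wproc := WProc {
  w_pc : PC;
  w_rf : Reg -> Val;
  w_ts : Reg -> nat;
  w_rts : nat;
  w_sb : seq wsb_entry;
  w_ib : seq ib_entry }.

Record wstate := WState {
  w_gts : nat;
  w_mem : Addr -> wmem_cell;
  w_proc : 'I_n -> wproc }.

Definition in_sb (a : Addr) (q : seq wsb_entry) : bool :=
  has (fun s => ws_addr s == a) q.

Definition ats (p : wproc) (srcs : seq Reg) : nat := \max_(r <- srcs) w_ts p r.

(* Timestamp at which processor i sees the content of a memory cell. *)
Definition seen_ts (i : 'I_n) (c : wmem_cell) : nat :=
  if c_writer c == Some i then c_sts c else c_mts c.

Definition write_reg (p : wproc) (npc : PC) (dst : Reg) (v : Val) (ts : nat)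
    (ib : seq ib_entry) : wproc :=
  WProc npc (upd (w_rf p) dst v) (upd (w_ts p) dst ts) (w_rts p) (w_sb p) ib.

Definition ib_clear (a : Addr) (ib : seq ib_entry) : seq ib_entry :=
  [seq x <- ib | ib_addr x != a].

(* An entry is inserted with upper bound the value of gts at its insertion, so
   the entries inserted when gts < tsU are those with a bound below tsU. *)
Definition ib_clear_before (a : Addr) (tsU : nat) (ib : seq ib_entry) :
    seq ib_entry :=
  [seq x <- ib | ~~ ((ib_addr x == a) && (ib_tsU x < tsU))].

Inductive wmmd_exec (i : 'I_n) (P : program) (gts : nat)
    (m : Addr -> wmem_cell) : wproc -> event -> wproc -> Prop :=
| WmmNm p op srcs dst npc v :
    fetch P (w_pc p) = Nm op srcs dst ->
    op (w_pc p) (map (w_rf p) srcs) = (npc, v) ->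
    wmmd_exec i P gts m p
      (Event (w_pc p) (fetch P (w_pc p)) (ResNm v npc))
      (write_reg p npc dst v (ats p srcs) (w_ib p))
| WmmLdSb p fa srcs dst a q1 v sts q2 :
    fetch P (w_pc p) = Ld fa srcs dst ->
    a = fa (map (w_rf p) srcs) ->
    w_sb p = q1 ++ WSb a v sts :: q2 ->
    ~~ in_sb a q2 ->
    wmmd_exec i P gts m p
      (Event (w_pc p) (fetch P (w_pc p)) (ResLd a v))
      (write_reg p (seqpc P (w_pc p)) dst v
         (maxn (ats p srcs) (maxn (w_rts p) sts)) (w_ib p))
| WmmLdMem p fa srcs dst a :
    fetch P (w_pc p) = Ld fa srcs dst ->
    a = fa (map (w_rf p) srcs) ->
    ~~ in_sb a (w_sb p) ->
    wmmd_exec i P gts m p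
      (Event (w_pc p) (fetch P (w_pc p)) (ResLd a (c_val (m a))))
      (write_reg p (seqpc P (w_pc p)) dst (c_val (m a))
         (maxn (ats p srcs) (maxn (w_rts p) (seen_ts i (m a))))
         (ib_clear a (w_ib p)))
| WmmLdIb p fa srcs dst a b1 v tsL tsU b2 :
    fetch P (w_pc p) = Ld fa srcs dst ->
    a = fa (map (w_rf p) srcs) ->
    ~~ in_sb a (w_sb p) ->
    w_ib p = b1 ++ Ib a v tsL tsU :: b2 ->
    ats p srcs <= tsU ->
    wmmd_exec i P gts m p
      (Event (w_pc p) (fetch P (w_pc p)) (ResLd a v))
      (write_reg p (seqpc P (w_pc p)) dst v
         (maxn (ats p srcs) (maxn (w_rts p) tsL))
         (ib_clear_before a tsU (w_ib p)))
| WmmSt p fa fd srcs a v :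
    fetch P (w_pc p) = St fa fd srcs ->
    a = fa (map (w_rf p) srcs) ->
    v = fd (map (w_rf p) srcs) ->
    wmmd_exec i P gts m p
      (Event (w_pc p) (fetch P (w_pc p)) (ResSt a v))
      (WProc (seqpc P (w_pc p)) (w_rf p) (w_ts p) (w_rts p)
         (rcons (w_sb p) (WSb a v (ats p srcs))) (ib_clear a (w_ib p)))
| WmmRec p :
    fetch P (w_pc p) = Reconcile ->
    wmmd_exec i P gts m p
      (Event (w_pc p) (fetch P (w_pc p)) ResFence)
      (WProc (seqpc P (w_pc p)) (w_rf p) (w_ts p) gts (w_sb p) [::])
| WmmCom p :
    fetch P (w_pc p) = Commit ->
    w_sb p = [::] ->
    wmmd_exec i P gts m p
      (Event (w_pc p) (fetch P (w_pc p)) ResFence)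
      (WProc (seqpc P (w_pc p)) (w_rf p) (w_ts p) (w_rts p) (w_sb p) (w_ib p)).

Definition wset_sb (p : wproc) (q : seq wsb_entry) : wproc :=
  WProc (w_pc p) (w_rf p) (w_ts p) (w_rts p) q (w_ib p).

(* Effect on processor j of overwriting the cell c of address a at time gts by
   a store of another processor. *)
Definition invalidate (gts : nat) (a : Addr) (c : wmem_cell) (j : 'I_n)
    (p : wproc) : wproc :=
  if in_sb a (w_sb p) then p
  else WProc (w_pc p) (w_rf p) (w_ts p) (w_rts p) (w_sb p)
         (rcons (w_ib p) (Ib a (c_val c) (seen_ts j c) gts)).

Inductive wmmd_step (prog : 'I_n -> program) :
    wstate -> option ('I_n * event) -> wstate -> Prop :=
| WStepExec s i x p' :
    wmmd_exec i (prog i) (w_gts s) (w_mem s) (w_proc s i) x p' ->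
    wmmd_step prog s (Some (i, x))
      (WState (w_gts s) (w_mem s) (upd (w_proc s) i p'))
| WStepDeq s i q1 a v sts q2 :
    w_sb (w_proc s i) = q1 ++ WSb a v sts :: q2 ->
    ~~ in_sb a q1 ->
    wmmd_step prog s None
      (WState (w_gts s).+1
         (upd (w_mem s) a (WCell v (Some i) sts (w_gts s).+1))
         (fun j => if j == i then wset_sb (w_proc s i) (q1 ++ q2)
                   else invalidate (w_gts s) a (w_mem s a) j (w_proc s j))).

Definition wmmd_init (s0 : init_state) : wstate :=
  WState 0
    (fun a => WCell (init_mem s0 a) None 0 0)
    (fun i => WProc (init_pc s0 i) (init_rf s0 i) (fun=> 0) 0 [::] [::]).

Definition wmmd_behavior (prog : 'I_n -> program) (s0 : init_state) :
    behavior -> Prop :=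
  is_behavior (wmmd_step prog) (wmmd_init s0)
    (fun s => forall i, w_sb (w_proc s i) = [::])
    (fun s a => c_val (w_mem s a)).

End Models.

(* Main.v *)
Require Import Defs.
From mathcomp Require Import all_boot zify.

(* Forward simulation: WMM-D executes an instruction when OOO retires it and
   dequeues a store when CCM performs it; all other steps are invisible.

   A load may have obtained its value long before it retires.  Call time the
   number gts of stores performed so far.  Since values are not predicted, the
   sources of a load were available at the time T when it read the memory, and
   the timestamps that WMM-D gives them never exceed max(T, rts); so, if the
   value has been overwritten meanwhile, it sits in the invalidation buffer in
   an entry with tsL <= max(T, rts) <= tsU, and the load can still be executed.
   No Reconcile can have emptied the buffer in between, because a load reads the
   memory only when no older Reconcile is left in the reorder buffer.  The
   flushes of OOO-StEx and respLd keep the values read by the pending loads of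
   an address in coherence order, so that the invalidation buffer entries that
   WMM-D removes when it executes a load are not needed by a younger one.

   The invariant of a reorder buffer entry mentions only older entries, so
   that it survives flushes. *)

Set Implicit Arguments.
Unset Strict Implicit.
Unset Printing Implicit Defensive.

(** * Most recent matches and decompositions of lists *)

Section Latest.
Variables (T B : Type).
Implicit Types (f : T -> option B) (s : seq T).

(** Lists run from oldest to youngest, so this is the answer of a search that starts at the youngest
    element. Looking up the writer of a source register and store forwarding both have this form. *)
Fixpoint latest f s : option B :=
  if s is x :: s' then if latest f s' is Some b then Some b else f x else None.

Lemma latest_cat f s1 s2 :
  latest f (s1 ++ s2) = if latest f s2 is Some b then Some b else latest f s1.
Proof.
elim: s1 => [|x s1 IH] /=; first by case: latest.
by rewrite IH; case: (latest f s2).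
Qed.

Lemma latest_cat_cons f s1 x s2 :
  latest f (s1 ++ x :: s2) =
  if latest f s2 is Some b then Some b
  else if f x is Some b then Some b else latest f s1.
Proof. by rewrite latest_cat /=; case: (latest f s2). Qed.

Lemma latest_split f s b : latest f s = Some b ->
  exists s1 x s2, [/\ s = s1 ++ x :: s2, f x = Some b & latest f s2 = None].
Proof.
elim: s => [|x s IH] //=; case E: (latest f s) => [b'|] h.
  have [s1 [y [s2 [-> fy n2]]]] := IH (etrans E h).
  by exists (x :: s1), y, s2.
by exists [::], x, s.
Qed.

End Latest.

(** Invariants are quantified over decompositions of a list. After one element has been replaced,
    the element under scrutiny is that one, a later one or an earlier one. *)
Lemma split_cases (T : Type) (x : seq T) e y u d v :
  x ++ e :: y = u ++ d :: v ->
  [\/ [/\ x = u, e = d & y = v],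
      exists2 w, u = x ++ e :: w & y = w ++ d :: v
    | exists2 w, x = u ++ d :: w & v = w ++ e :: y].
Proof.
elim: x u => [|z x IH] [|z' u] /=.
- by case=> -> ->; constructor 1.
- by case=> -> ->; constructor 2; exists u.
- by case=> -> <-; constructor 3; exists x.
- case=> -> /IH[[-> -> ->]|[w -> ->]|[w -> ->]].
  + by constructor 1.
  + by constructor 2; exists w.
  + by constructor 3; exists w.
Qed.

Lemma all_splits (T : Type) (Q : pred T) (s : seq T) :
  (forall x e y, s = x ++ e :: y -> Q e) -> all Q s.
Proof.
elim: s => [|e s IH] //= h; rewrite (h [::] e s) //=.
by apply: IH => x e' y E; apply: (h (e :: x) e' y); rewrite E.
Qed.

(** * Invariants of a processor *)

Section Simulation.

Context (Reg Addr PC : eqType) (Val : Type) (n : nat).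
Variables (i : 'I_n) (P : program Reg Addr PC Val).

Local Notation tag := (Defs.tag Addr n).
Local Notation entry := (entry Reg Addr PC Val n).
Local Notation proc := (proc Reg Addr PC Val n).
Local Notation wproc := (wproc Reg Addr PC Val).
Local Notation sb_entry := (sb_entry Addr Val n).
Local Notation request := (request Addr Val n).
Local Notation BypassTop := (BypassTop Addr Val n).
Local Notation BypassEps := (BypassEps Addr Val n).

(* [x_over t] is the value of gts when the store tagged t was overwritten in
   memory, and [x_tm (inr (i, k))] the value of gts when the entry at index k
   was executed; once a store has left the reorder buffer, [x_tm] of its tag is
   the creation timestamp that WMM-D gave it. *)
Record ctx := Ctx {
  x_mem : Addr -> Val * tag;
  x_wmem : Addr -> wmem_cell Val n;
  x_over : tag -> option nat;
  x_tm : tag -> nat;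
  x_w : wproc;
  x_sb : seq sb_entry }.

Implicit Types (c : ctx) (e d : entry) (es pre : seq entry) (a : Addr)
  (t : tag) (w : wproc) (p : proc) (srcs : seq Reg).

(** For a store this is the tag assigned at fetch. Using it for loads and Nm entries too lets the
    single function [x_tm] hold the times of all entries. *)
Definition key e : tag := inr (i, e_idx e).

Definition writer (r : Reg) pre : option entry :=
  latest (fun e => if dst_of (e_ins e) == Some r then Some e else None) pre.

Definition src c pre r : option Val :=
  if writer r pre is Some e then e_val e else Some (w_rf (x_w c) r).

Definition src_tm c pre r : nat :=
  if writer r pre is Some e then x_tm c (key e) else w_ts (x_w c) r.

(** One equation of lists expresses both that all sources are ready and what their values are. *)
Definition srcs_val c pre srcs vs : Prop :=
  [seq src c pre r | r <- srcs] = [seq Some v | v <- vs].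

(* The maximum with rts accounts for an older Reconcile that retires after the
   execution of the entry. *)
Definition srcs_tm c pre t srcs : Prop :=
  forall r, r \in srcs -> src_tm c pre r <= maxn (x_tm c t) (w_rts (x_w c)).

(** [None] lets the search go on to the next older entry, whereas [Some BypassEps] ends it at a
    Reconcile. *)
Definition bypass_entry a e : option (bypass_result Addr Val n) :=
  match e_ins e, e_addr e, e_val e, e_tag e with
  | Reconcile, _, _, _ => Some BypassEps
  | St _ _ _, Some a', Some v, Some t =>
      if a' == a then Some (BypassHit v t) else None
  | _, _, _, _ => None
  end.

Definition base c a := bypass_sb a (rev (x_sb c)).

Definition bypass c pre a : bypass_result Addr Val n :=
  if latest (bypass_entry a) pre is Some b then b else base c a.

(* In coherence order; a store with no [over] is the current value of memory, or
   not performed yet. *)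
Definition not_newer (over : tag -> option nat) t1 t2 : Prop :=
  t1 = t2 \/
  exists2 u1, over t1 = Some u1 & forall u2, over t2 = Some u2 -> u1 <= u2.

Definition coherent c pre a t : Prop :=
  forall x e1 y t1, pre = x ++ e1 :: y -> is_ld (e_ins e1) ->
    is_done (e_ex e1) -> e_addr e1 = Some a -> e_tag e1 = Some t1 ->
    not_newer (x_over c) t1 t.

(* The load tagged k, having read v, tagged t, from the memory, can still be
   executed in WMM-D, from the memory or from the invalidation buffer. *)
Definition readable c k a v t : Prop :=
  (x_mem c a = (v, t) /\
     seen_ts i (x_wmem c a) <= maxn (x_tm c k) (w_rts (x_w c))) \/
  exists b1 L U b2,
    [/\ x_over c t = Some U, w_ib (x_w c) = b1 ++ Ib a v L U :: b2,
        L <= maxn (x_tm c k) (w_rts (x_w c))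
      & maxn (x_tm c k) (w_rts (x_w c)) <= U].

(** An executed load must agree with what the forwarding search would return now, not only with what
    it returned at execution. Once the load is the oldest entry, the case of this match selects the
    WMM-D rule that executes it. *)
Definition ld_ok c pre k a v t : Prop :=
  match bypass c pre a with
  | BypassHit v' t' =>
      [/\ v' = v, t' = t & x_tm c t <= maxn (x_tm c k) (w_rts (x_w c))]
  | Defs.BypassTop => readable c k a v t /\ coherent c pre a t
  | Defs.BypassEps => False
  end.

(** An unexecuted store has no address, so a store with an address is visible to forwarding. A load
    in state [Exe] must still be due to read the memory when its response arrives; [ReEx] carries no
    such condition because its response is discarded. *)
Definition ent_ok c pre e : Prop :=
  [/\ e_ins e = fetch P (e_pc e),
      ~~ is_nm (e_ins e) -> e_npc e = seqpc P (e_pc e),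
      ~~ is_done (e_ex e) -> e_val e = None
    & match e_ins e with
      | Nm op srcs dst =>
          is_done (e_ex e) -> exists vs v,
            [/\ srcs_val c pre srcs vs, op (e_pc e) vs = (e_npc e, v),
                e_val e = Some v & srcs_tm c pre (key e) srcs]
      | Ld fa srcs dst =>
          [/\ forall a, e_addr e = Some a ->
                exists2 vs, srcs_val c pre srcs vs & a = fa vs,
              e_ex e = Exe -> forall a, e_addr e = Some a ->
                bypass c pre a = BypassTop
            & is_done (e_ex e) -> exists a v t,
                [/\ e_addr e = Some a, e_val e = Some v, e_tag e = Some t,
                    srcs_tm c pre (key e) srcs & ld_ok c pre (key e) a v t]]
      | St fa fd srcs =>
          e_tag e = Some (key e) /\
          if is_done (e_ex e) then exists vs,
            [/\ srcs_val c pre srcs vs, e_addr e = Some (fa vs),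
                e_val e = Some (fd vs) & srcs_tm c pre (key e) srcs]
          else e_addr e = None
      | _ => True
      end].

Definition rob_ok c es : Prop :=
  forall x e y, es = x ++ e :: y -> ent_ok c x e.

(** * The forwarding search *)

Lemma bypass_robE a pre q :
  bypass_rob a (rev pre) q =
  if latest (bypass_entry a) pre is Some b then b else bypass_sb a q.
Proof.
elim/last_ind: pre => [|pre e IH] //.
rewrite rev_rcons -cats1 latest_cat /= IH /bypass_entry.
case: (e_ins e) => //= *; move: (e_addr e) (e_val e) (e_tag e);
  by move=> [a'|] [v|] [t|] //=; case: eqP.
Qed.

Lemma bypass_sb_hit a (q : seq sb_entry) v t :
  bypass_sb a (rev q) = BypassHit v t ->
  exists q1 b q2, q = q1 ++ SbEntry a v t b :: q2 /\
    ~~ has (fun s => s_addr s == a) q2.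
Proof.
elim/last_ind: q => [|q [a' v' t' b'] IH] //=.
rewrite rev_rcons /=; case: eqP => [->|ne].
  by case=> -> ->; exists q, b', [::]; rewrite cats1.
case/IH=> [q1 [b [q2 [-> h]]]]; exists q1, b, (rcons q2 (SbEntry a' v' t' b')).
by rewrite -rcons_cons -rcons_cat -cats1 has_rcons /= (introF eqP ne).
Qed.

Lemma bypass_sb_cat a (q1 q2 : seq sb_entry) :
  bypass_sb a (rev (q1 ++ q2)) =
  if has (fun s => s_addr s == a) q2 then bypass_sb a (rev q2)
  else bypass_sb a (rev q1).
Proof.
elim/last_ind: q2 => [|q2 s IH]; first by rewrite cats0.
rewrite -rcons_cat !rev_rcons has_rcons /= IH.
by case: eqP.
Qed.

Lemma bypass_sb_top a (q : seq sb_entry) :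
  (bypass_sb a (rev q) = BypassTop) <-> ~~ has (fun s => s_addr s == a) q.
Proof.
elim/last_ind: q => [|q s IH] //; rewrite rev_rcons has_rcons /=.
by case: eqP.
Qed.

Lemma bypass_entry_ld a e : is_ld (e_ins e) -> bypass_entry a e = None.
Proof. by rewrite /bypass_entry; case: (e_ins e). Qed.

Lemma bypass_entry_top a e : bypass_entry a e <> Some BypassTop.
Proof.
case: e => k pc npc ins ex [a'|] [v|] [t|]; rewrite /bypass_entry /=;
  by case: ins => //= *; case: eqP.
Qed.

Lemma bypass_topE c pre a : bypass c pre a = BypassTop <->
  latest (bypass_entry a) pre = None /\ base c a = BypassTop.
Proof.
rewrite /bypass; case E: latest => [b|]; split=> [h|[]] //; subst b.
by have [s1 [e [s2 [_ /bypass_entry_top]]]] := latest_split E.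
Qed.

(** Fewer entries stop the search from an older position, so it falls through to memory there as
    well. *)
Lemma bypass_top_cat c x y a : bypass c (x ++ y) a = BypassTop ->
  bypass c x a = BypassTop.
Proof.
case/bypass_topE; rewrite latest_cat; case E: (latest _ y) => //.
by move=> h1 h2; apply/bypass_topE.
Qed.

(** Every change of the context or of the older entries passes through this lemma. Ready sources
    keep their values, and their timestamps may grow only up to rts, which the bound in [srcs_tm]
    absorbs; what remains specific to each rule is the effect on loads. *)
Lemma ent_ok_weaken c c' pre pre' e :
  ent_ok c pre e ->
  (forall r v, src c pre r = Some v ->
     src c' pre' r = Some v /\
     src_tm c' pre' r <= maxn (src_tm c pre r) (w_rts (x_w c'))) ->
  w_rts (x_w c) <= w_rts (x_w c') ->
  x_tm c (key e) <= x_tm c' (key e) ->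
  (is_ld (e_ins e) -> e_ex e = Exe -> forall a, e_addr e = Some a ->
     bypass c pre a = BypassTop -> bypass c' pre' a = BypassTop) ->
  (is_ld (e_ins e) -> e_ex e = Done -> forall a v t, e_addr e = Some a ->
     e_val e = Some v -> e_tag e = Some t ->
     ld_ok c pre (key e) a v t -> ld_ok c' pre' (key e) a v t) ->
  ent_ok c' pre' e.
Proof.
move=> [Hf Hn Hv He] Hs Hrts Htm Hexe Hdone; split=> //.
have Hsv srcs vs : srcs_val c pre srcs vs -> srcs_val c' pre' srcs vs.
  rewrite /srcs_val; elim: srcs vs => [|r srcs IH] [|v vs] //= [e1 e2].
  by rewrite (Hs _ _ e1).1 (IH _ e2).
have Hst srcs vs : srcs_val c pre srcs vs -> srcs_tm c pre (key e) srcs ->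
    srcs_tm c' pre' (key e) srcs.
  move=> hv ht r rin; have [v hr] : exists v, src c pre r = Some v.
    move: hv rin; rewrite /srcs_val; clear.
    elim: srcs vs => [|r' srcs IH] [|v vs] //= [e1 e2].
    rewrite in_cons => /orP[/eqP->|/(IH _ e2)//]; by exists v.
  have [_ h] := Hs _ _ hr; have := ht _ rin; lia.
move: Hexe Hdone He.
case: (e_ins e) => //=.
- move=> op srcs dst _ _ h /h[vs [v [h1 h2 h3 h4]]]; exists vs, v; split=> //.
  + exact: Hsv.
  + exact: Hst h1 h4.
- move=> fa srcs dst Hexe Hdone [h1 h2 h3]; split.
  + by move=> a /h1[vs hv ->]; exists vs => //; apply: Hsv.
  + by move=> hx a ha; apply: Hexe => //; apply: h2.
  + move=> hd; have [a [v [t [ha hv ht hs hl]]]] := h3 hd.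
    have [vs hvs _] := h1 _ ha.
    exists a, v, t; split=> //; first exact: Hst hvs hs.
    by apply: Hdone => //; case: (e_ex e) hd.
- move=> fa fd srcs _ _ [h1]; case: is_done => // h; split=> //.
  have [vs [hv ha hval hs]] := h; exists vs; split=> //; first exact: Hsv.
  exact: Hst hv hs.
Qed.


(** * Uniqueness of indices; updating or retiring one entry *)

Definition tag_idx t : nat := if t is inr (_, k) then k else 0.

(** This excludes tags of initial values from the store buffer, so the default 0 of [tag_idx] is
    harmless there. *)
Definition sb_own (q : seq sb_entry) : bool :=
  all (fun s => s_tag s == inr (i, tag_idx (s_tag s))) q.

(** A retiring store moves from the head of the reorder buffer to the end of the store buffer, which
    leaves this concatenation unchanged; hence it stays sorted. *)
Definition idxs (q : seq sb_entry) es : seq nat :=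
  [seq tag_idx (s_tag s) | s <- q] ++ [seq e_idx e | e <- es].

Definition st_own es : bool :=
  all (fun e => if e_ins e is St _ _ _ then e_tag e == Some (key e) else true) es.

Lemma rob_ok_st_own c es : rob_ok c es -> st_own es.
Proof.
move=> h; apply: all_splits => x e y /h[_ _ _]; case: (e_ins e) => //.
by move=> fa fd srcs [-> _].
Qed.

Lemma bypass_entry_hit a e v t : bypass_entry a e = Some (BypassHit v t) ->
  [/\ exists fa fd srcs, e_ins e = St PC fa fd srcs, e_addr e = Some a,
      e_val e = Some v & e_tag e = Some t].
Proof.
rewrite /bypass_entry; case: (e_ins e) => // fa fd srcs.
case: (e_addr e) (e_val e) (e_tag e) => [a'|] [v'|] [t'|] //.
case: eqP => // -> [-> ->]; split=> //; by exists fa, fd, srcs.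
Qed.

(** Locates the forwarding store among the live indices, so that changing [x_tm] at the key of
    another entry does not affect the timestamp of the forwarded value. *)
Lemma hit_idx c pre a v t : sb_own (x_sb c) -> st_own pre ->
  bypass c pre a = BypassHit v t ->
  exists2 k, t = inr (i, k) & k \in idxs (x_sb c) pre.
Proof.
move=> hq hp; rewrite /bypass; case E: latest => [b|] hb.
  subst b; have [u [e [w [def_pre he _]]]] := latest_split E.
  move: hp; rewrite def_pre /st_own all_cat /= => /and3P[_ + _].
  have [[fa [fd [srcs ->]]] _ _ ->] := bypass_entry_hit he.
  move=> /eqP[->]; exists (e_idx e) => //.
  by rewrite /idxs map_cat !mem_cat /= inE eqxx !orbT.
have [q1 [b [q2 [def_q _]]]] := bypass_sb_hit hb.
move: hq; rewrite def_q /sb_own all_cat /= => /and3P[_ /eqP-> _].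
exists (tag_idx t) => //.
by rewrite /idxs map_cat !mem_cat /= inE eqxx !orbT.
Qed.

Lemma idxs_cat_cons q x e y :
  perm_eq (idxs q (x ++ e :: y)) (e_idx e :: idxs q (x ++ y)).
Proof.
rewrite /idxs !map_cat /= catA -cat_rcons -cats1 -!catA.
rewrite -[_ :: _ ++ _]/([:: e_idx e] ++ _).
by rewrite !catA perm_cat2r perm_catC catA.
Qed.

Lemma bypass_skip c x e y a : bypass_entry a e = None ->
  bypass c (x ++ e :: y) a = bypass c (x ++ y) a.
Proof. by move=> h; rewrite /bypass latest_cat_cons latest_cat h; case: latest. Qed.

Lemma writer_idx q r x e : writer r x = Some e -> e_idx e \in idxs q x.
Proof.
move=> h; have [s1 [e1 [s2 [-> + _]]]] := latest_split h.
case: eqP => // _ [->].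
by rewrite /idxs map_cat !mem_cat /= inE eqxx !orbT.
Qed.

Lemma mem_idxs q x y k : k \in idxs q x -> k \in idxs q (x ++ y).
Proof. by rewrite /idxs map_cat !mem_cat => /orP[->|->] //; rewrite orbT. Qed.

Lemma mem_idxs_r q x y k : k \in idxs q y -> k \in idxs q (x ++ y).
Proof. by rewrite /idxs map_cat !mem_cat => /orP[->|->] //; rewrite !orbT. Qed.

Lemma rob_ok_cat c x y : rob_ok c (x ++ y) -> rob_ok c x.
Proof. by move=> h u e v def_x; apply: (h u e (v ++ y)); rewrite def_x -catA. Qed.

(** The common shape of an execution: [e] becomes [e'], its time is set, and the entries [z] are
    flushed. Younger entries with ready sources did not read [e], which had no value, and uniqueness
    of indices protects their times. Forwarding to younger loads and coherence with them depend on
    the rule and are left as hypotheses. *)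
Lemma rob_ok_upd c tm' x e e' y z :
  let c' := Ctx (x_mem c) (x_wmem c) (x_over c) tm' (x_w c) (x_sb c) in
  rob_ok c (x ++ e :: y ++ z) -> sb_own (x_sb c) ->
  uniq (idxs (x_sb c) (x ++ e :: y ++ z)) ->
  (forall a, bypass_entry a e = None) -> e_val e = None ->
  e_ins e' = e_ins e -> e_idx e' = e_idx e ->
  (forall t, t <> key e -> tm' t = x_tm c t) ->
  ent_ok c' x e' ->
  (forall y0 e2 y1 a, y = y0 ++ e2 :: y1 -> is_ld (e_ins e2) ->
     e_addr e2 = Some a -> e_ex e2 = Exe \/ e_ex e2 = Done ->
     bypass c (x ++ e' :: y0) a = bypass c (x ++ e :: y0) a) ->
  (forall y0 e2 y1 a t1 t2, y = y0 ++ e2 :: y1 -> is_ld (e_ins e2) ->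
     e_ex e2 = Done -> e_addr e2 = Some a -> e_tag e2 = Some t2 ->
     bypass c (x ++ e :: y0) a = BypassTop ->
     is_ld (e_ins e) -> is_done (e_ex e') -> e_addr e' = Some a ->
     e_tag e' = Some t1 -> not_newer (x_over c) t1 t2) ->
  rob_ok c' (x ++ e' :: y).
Proof.
move=> c' hok hq hu hb hv hins hidx htm hx hby hco u d v E.
have hnot : e_idx e \notin idxs (x_sb c) (x ++ y ++ z).
  by move: hu; rewrite (perm_uniq (idxs_cat_cons _ _ _ _)) => /andP[].
have htm_idx k : k \in idxs (x_sb c) (x ++ y ++ z) -> tm' (inr (i, k)) = x_tm c (inr (i, k)).
  by move=> hk; apply: htm => -[e1]; move: hnot; rewrite -e1 hk.
have hst := rob_ok_st_own hok.
have [[hxu hd hy]|[w hxu hy]|[w hxu hy]] := split_cases E.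
- by rewrite -hxu -hd.
- have hd : ent_ok c (x ++ e :: w) d.
    by apply: (hok _ _ (v ++ z)); rewrite hy -!catA.
  rewrite hxu; have kd : x_tm c (key d) = tm' (key d).
    rewrite htm_idx // hy /idxs !map_cat !mem_cat /= inE eqxx.
    by rewrite !orbT.
  apply: (ent_ok_weaken hd) => //.
  + move=> r val; rewrite /src /src_tm /= /writer !latest_cat_cons hins.
    case Ew: (latest _ w) => [e3|].
      move=> ->; split=> //; rewrite htm_idx ?leq_max ?leqnn //.
      have /(mem_idxs (d :: v)) h := writer_idx (x_sb c) Ew.
      by apply/mem_idxs_r/mem_idxs; rewrite hy.
    (* If [e] were the writer of [r], the source would not have been ready. *)
    case: eqP => [_|_]; first by rewrite hv.
    case Ex: (latest _ x) => [e3|] h; split=> //; rewrite ?leq_max ?leqnn //.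
    rewrite htm_idx ?leqnn //; apply/mem_idxs.
    exact: writer_idx Ex.
  + by rewrite kd.
  + move=> hl he a ha; rewrite -(hby _ _ _ _ hy hl ha) //; by left.
  + move=> hl he a val t ha hval ht; rewrite /ld_ok.
    have -> : bypass c' (x ++ e' :: w) a = bypass c (x ++ e :: w) a.
      by rewrite -(hby _ _ _ _ hy hl ha) //; right.
    case Eb: bypass => [||v' t'] //.
      move=> [hr hc]; split.
        by move: hr; rewrite /readable /= kd.
      move=> x1 e1 y1 t1 E' h1 h2 h3 h4.
      have [[_ E1 _]|[w1 _ E1]|[w1 E1 _]] := split_cases E'.
      * subst e1; apply: (hco _ _ _ _ _ _ hy hl he ha ht Eb) => //.
        by rewrite -hins.
      * by apply: (hc (x ++ e :: w1) e1 y1) => //; rewrite E1 -catA.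
      * by apply: (hc x1 e1 (w1 ++ e :: w)) => //; rewrite E1 -catA.
    case=> [-> et] hle; split=> //=; rewrite -kd; subst t'.
    have hs2 : st_own (x ++ w).
      move: hst; rewrite hy /st_own !all_cat /= !all_cat.
      by move=> /andP[-> /andP[_ /andP[/andP[-> _] _]]].
    move: Eb; rewrite bypass_skip // => Eb.
    have [k ek hk] := hit_idx hq hs2 Eb; subst t.
    by rewrite htm_idx // hy -!catA catA; apply: mem_idxs.
- have hd : ent_ok c u d.
    by apply: (hok _ _ (w ++ e :: y ++ z)); rewrite hxu -!catA.
  have kd : x_tm c (key d) = tm' (key d).
    rewrite htm_idx // hxu /idxs !map_cat !mem_cat /= inE eqxx.
    by rewrite !orbT.
  apply: (ent_ok_weaken hd) => //.
  + move=> r val; rewrite /src /src_tm /=.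
    case Ew: (writer r u) => [e3|] h; split=> //; rewrite ?leq_max ?leqnn //.
    rewrite htm_idx ?leqnn //; rewrite hxu -catA.
    exact/mem_idxs/(writer_idx _ Ew).
  + by rewrite kd.
  + move=> hl he a val t ha hval ht; rewrite /ld_ok.
    rewrite -[bypass c' u a]/(bypass c u a).
    case Eb: bypass => [||v' t'] //.
      move=> [hr hc]; split=> //.
      by move: hr; rewrite /readable /= kd.
    case=> [-> et] hle; split=> //=; rewrite -kd; subst t'.
    have hs2 : st_own u.
      by move: hst; rewrite hxu /st_own !all_cat => /andP[/andP[-> _] _].
    have [k ek hk] := hit_idx hq hs2 Eb; subst t.
    by rewrite htm_idx //; rewrite hxu -!catA; apply: mem_idxs.
Qed.

(** Retirement moves the contribution of the oldest entry into the registers or the store buffer,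
    where the remaining entries find it again. A Reconcile leaves [base] unconstrained because no
    younger executed load has a search that stops at it. *)
Lemma rob_ok_commit c c' e es :
  rob_ok c (e :: es) -> uniq (idxs (x_sb c) (e :: es)) ->
  x_over c' = x_over c ->
  (forall r, Some (w_rf (x_w c') r) =
     if dst_of (e_ins e) == Some r then e_val e else Some (w_rf (x_w c) r)) ->
  (forall r, w_ts (x_w c') r <=
     maxn (if dst_of (e_ins e) == Some r then x_tm c (key e)
           else w_ts (x_w c) r) (w_rts (x_w c'))) ->
  w_rts (x_w c) <= w_rts (x_w c') ->
  (forall t, x_tm c' t <= maxn (x_tm c t) (w_rts (x_w c'))) ->
  (forall t, t <> key e -> x_tm c' t = x_tm c t) ->
  (forall a, match bypass_entry a e with
     | None => base c' a = base c a
     | Some Defs.BypassEps => True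
     | Some b => base c' a = b
     end) ->
  (forall y0 e2 y1 a v t, es = y0 ++ e2 :: y1 ->
     bypass c (e :: y0) a = BypassTop -> readable c (key e2) a v t ->
     (is_ld (e_ins e) -> is_done (e_ex e) -> e_addr e = Some a ->
      forall t1, e_tag e = Some t1 -> not_newer (x_over c) t1 t) ->
     x_tm c' (key e2) = x_tm c (key e2) ->
     readable c' (key e2) a v t) ->
  rob_ok c' es.
Proof.
move=> hok hu hov hrf hts hrts htm1 htm2 hbase hread u d v def_es.
have hd : ent_ok c (e :: u) d by apply: (hok _ _ v); rewrite def_es.
have hnot : e_idx e \notin idxs (x_sb c) es.
  by move: hu; rewrite (perm_uniq (idxs_cat_cons _ [::] _ _)) => /andP[].
have htm_idx k : k \in idxs (x_sb c) es -> x_tm c' (inr (i, k)) = x_tm c (inr (i, k)).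
  by move=> hk; apply: htm2 => -[e1]; move: hnot; rewrite -e1 hk.
have kd : x_tm c' (key d) = x_tm c (key d).
  by rewrite htm_idx // def_es /idxs map_cat !mem_cat /= inE eqxx !orbT.
have hby a b : bypass c (e :: u) a = b -> b <> BypassEps -> bypass c' u a = b.
  rewrite /bypass /=; case: (latest _ u) => [b'|] //.
  by have := hbase a; case: bypass_entry => [[||v' t']|] h <- => //; rewrite h.
apply: (ent_ok_weaken hd) => //.
- move=> r val; rewrite /src /src_tm /= /writer /=.
  case Ew: (latest _ u) => [e3|].
    move=> ->; split=> //; rewrite htm_idx ?leq_max ?leqnn // def_es.
  by have := hts r; have := hrf r; case: eqP => [_|_] -> // hle ->.
- by rewrite kd.
- by move=> _ _ a _ /hby; apply.
- move=> hl he a val t ha hval ht; rewrite /ld_ok.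
  case Eb: (bypass c) => [||v' t'] //; rewrite (hby _ _ Eb) //.
    move=> [hr hc]; split.
      apply: hread (def_es) Eb hr _ kd => h1 h2 h3 t1 h4.
      exact: (hc [::] e u).
    move=> x1 e1 y1 t1 def_u; rewrite hov; apply: (hc (e :: x1) e1 y1).
    by rewrite def_u.
  case=> [-> et] hle; split=> //=; rewrite kd; have := htm1 t; lia.
Qed.

(** * The invariant linking a processor to its WMM-D counterpart *)

Fixpoint chain (pc : PC) es (pc' : PC) : Prop :=
  if es is e :: es' then e_pc e = pc /\ chain (e_npc e) es' pc' else pc = pc'.

Lemma chain_cat pc x e y pc' :
  chain pc (x ++ e :: y) pc' <-> chain pc x (e_pc e) /\ chain (e_npc e) y pc'.
Proof.
elim: x pc => [|d x IH] pc /=; first by split=> -[-> h].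
by rewrite IH; split=> [[-> [h1 h2]]|[[-> h1] h2]].
Qed.

(** The tag has never reached the memory: it is neither current nor overwritten. *)
Definition unspent c t := x_over c t = None /\ forall a, (x_mem c a).2 <> t.

Definition wsb (tm : tag -> nat) (s : sb_entry) : wsb_entry Addr Val :=
  WSb (s_addr s) (s_val s) (tm (s_tag s)).

Lemma map_wsb tm tm' q e : sb_own q ->
  e_idx e \notin [seq tag_idx (s_tag s) | s <- q] ->
  (forall t, t <> key e -> tm' t = tm t) ->
  map (wsb tm') q = map (wsb tm) q.
Proof.
move=> + + htm; elim: q => [|s q IH] //= /andP[/eqP hs /IH{}IH].
rewrite inE negb_or => /andP[hne /IH->]; congr (_ :: _).
by rewrite /wsb htm // => et; move: hne; rewrite et eqxx.
Qed.

(** [k_chain] makes the oldest entry the instruction that WMM-D executes next. [k_unspent] includes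
    the indices not allocated yet, so that a fetch preserves it. *)
Record core gts c p : Prop := Core {
  k_sb : x_sb c = sb p;
  k_chain : chain (w_pc (x_w c)) (rob p) (pcr p);
  k_rf : w_rf (x_w c) = rf p;
  k_wsb : w_sb (x_w c) = map (wsb (x_tm c)) (sb p);
  k_own : sb_own (sb p);
  k_sorted : sorted ltn (idxs (sb p) (rob p));
  k_bound : all (fun k => k < idx_bound p) (idxs (sb p) (rob p));
  k_unspent : forall k, k \in idxs (sb p) (rob p) \/ idx_bound p <= k ->
    unspent c (inr (i, k));
  k_ts : forall r, w_ts (x_w c) r <= gts;
  k_rts : w_rts (x_w c) <= gts;
  k_tm : forall t, x_tm c t <= gts;
  k_rob : rob_ok c (rob p) }.

Lemma k_uniq gts c p : core gts c p -> uniq (idxs (sb p) (rob p)).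
Proof. by move=> h; apply: sorted_uniq (k_sorted h); [apply: ltn_trans|exact: ltnn]. Qed.

Definition with_tm c tm' := Ctx (x_mem c) (x_wmem c) (x_over c) tm' (x_w c) (x_sb c).

Lemma core_ext gts c p p' : core gts c p -> pcr p' = pcr p -> rf p' = rf p ->
  rob p' = rob p -> sb p' = sb p -> idx_bound p' = idx_bound p ->
  core gts c p'.
Proof.
by case=> ? ? ? ? ? ? ? ? ? ? ? ? E1 E2 E3 E4 E5; split; rewrite ?E1 ?E2 ?E3 ?E4 ?E5.
Qed.

(** This covers flushes: fetching resumes at the PC of the first deleted entry, which is where the
    chain of the kept entries ends. *)
Lemma core_take gts c p p' x y : core gts c p -> rob p = x ++ y ->
  pcr p' = (if y is e :: _ then e_pc e else pcr p) ->
  rf p' = rf p -> rob p' = x -> sb p' = sb p -> idx_bound p' = idx_bound p ->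
  core gts c p'.
Proof.
case=> k1 k2 k3 k4 k5 k6 k7 k8 k9 k10 k11 k12 E hpc hrf hrob hsb hbd.
have Eidx : idxs (sb p) (rob p) = idxs (sb p) x ++ [seq e_idx e | e <- y].
  by rewrite E /idxs map_cat catA.
split; rewrite ?hrf ?hrob ?hsb ?hbd //.
- move: k2; rewrite E hpc; case: y {E Eidx hpc} => [|e y]; first by rewrite cats0.
  by move/chain_cat=> [].
- by move: k6; rewrite Eidx => /cat_sorted2[].
- by move: k7; rewrite Eidx all_cat => /andP[].
- move=> k [hk|hk]; apply: k8; last by right.
  by left; rewrite Eidx mem_cat hk.
- by move: k12; rewrite E; apply: rob_ok_cat.
Qed.

Lemma core_upd gts c tm' p p' x e e' y z :
  core gts c p -> rob p = x ++ e :: y ++ z ->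
  (forall a, bypass_entry a e = None) -> e_val e = None ->
  e_ins e' = e_ins e -> e_idx e' = e_idx e -> e_pc e' = e_pc e ->
  (forall t, t <> key e -> tm' t = x_tm c t) -> (forall t, tm' t <= gts) ->
  let c' := with_tm c tm' in
  ent_ok c' x e' ->
  (forall y0 e2 y1 a, y = y0 ++ e2 :: y1 -> is_ld (e_ins e2) ->
     e_addr e2 = Some a -> e_ex e2 = Exe \/ e_ex e2 = Done ->
     bypass c (x ++ e' :: y0) a = bypass c (x ++ e :: y0) a) ->
  (forall y0 e2 y1 a t1 t2, y = y0 ++ e2 :: y1 -> is_ld (e_ins e2) ->
     e_ex e2 = Done -> e_addr e2 = Some a -> e_tag e2 = Some t2 ->
     bypass c (x ++ e :: y0) a = BypassTop ->
     is_ld (e_ins e) -> is_done (e_ex e') -> e_addr e' = Some a ->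
     e_tag e' = Some t1 -> not_newer (x_over c) t1 t2) ->
  chain (e_npc e') y (pcr p') ->
  rf p' = rf p -> rob p' = x ++ e' :: y -> sb p' = sb p ->
  idx_bound p' = idx_bound p ->
  core gts c' p'.
Proof.
move=> K; have hu := k_uniq K.
case: K => k1 k2 k3 k4 k5 k6 k7 k8 k9 k10 k11 k12 E hb hv hins hidx hpc htm htm' c' he' hby hco.
move=> hchain hrf hrob hsb hbd.
have Eidx : idxs (sb p) (rob p) = idxs (sb p) (x ++ e' :: y) ++ [seq e_idx e | e <- z].
  by rewrite E -cat_cons catA /idxs map_cat catA !map_cat /= hidx.
split; rewrite ?hrf ?hrob ?hsb ?hbd //.
- move: k2; rewrite E => /chain_cat[h1 h2]; apply/chain_cat; by rewrite hpc.
- rewrite k4; apply: esym; apply: (map_wsb (e := e)) => //; move: hu.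
  rewrite E /idxs map_cat /= catA uniq_catC /= => /andP[+ _].
  by rewrite mem_cat negb_or => /andP[_]; rewrite mem_cat negb_or => /andP[].
- by move: k6; rewrite Eidx => /cat_sorted2[].
- by move: k7; rewrite Eidx all_cat => /andP[].
- move=> k [hk|hk]; apply: k8; last by right.
  by left; rewrite Eidx mem_cat hk.
- rewrite E -k1 in hu; rewrite E in k12; rewrite -k1 in k5.
  exact: (rob_ok_upd k12 k5 hu hb hv hins hidx htm he' hby hco).
Qed.


(** * Entries located by index, and the loop over affected loads *)

Lemma idxs_rob_sorted gts c p : core gts c p -> sorted ltn [seq e_idx e | e <- rob p].
Proof. by move/k_sorted => /cat_sorted2[]. Qed.

Lemma sorted_split (x : seq entry) e y :
  sorted ltn [seq e_idx e | e <- x ++ e :: y] ->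
  all (fun d => e_idx d < e_idx e) x /\ all (fun d => e_idx e < e_idx d) y.
Proof.
rewrite map_cat /= (sorted_pairwise ltn_trans) pairwise_cat allrel_consr /=.
by case/and3P=> /andP[+ _] _ /andP[+ _]; rewrite !all_map.
Qed.

Lemma filter_none (T : Type) (Q : pred T) (s : seq T) :
  all (predC Q) s -> [seq z <- s | Q z] = [::].
Proof. by elim: s => [|z s IH] //= /andP[/negbTE-> /IH]. Qed.

Section Split.
Variables (p : proc) (x y : seq entry) (e : entry).
Hypothesis (Hs : sorted ltn [seq e_idx e | e <- rob p]) (Hp : rob p = x ++ e :: y).

Let Hx : all (fun d => e_idx d < e_idx e) x.
Proof. by move: Hs; rewrite Hp => /sorted_split[]. Qed.
Let Hy : all (fun d => e_idx e < e_idx d) y.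
Proof. by move: Hs; rewrite Hp => /sorted_split[]. Qed.

Lemma filter_older k : (forall d, e_idx d < e_idx e -> e_idx d < k) ->
  [seq d <- x | e_idx d < k] = x.
Proof. by move=> h; apply/all_filterP; apply: sub_all Hx => d /h. Qed.

Lemma lookup_at : lookup p (e_idx e) = Some e.
Proof.
rewrite /lookup Hp filter_cat filter_none /= ?eqxx //.
by apply: sub_all Hx => d /=; lia.
Qed.

Lemma older_at : older p (e_idx e) = x.
Proof.
rewrite /older Hp filter_cat /= ltnn filter_older // filter_none ?cats0 //.
by apply: sub_all Hy => d /=; lia.
Qed.

Lemma younger_at : younger p (e_idx e) = y.
Proof.
rewrite /younger Hp filter_cat /= ltnn filter_none; last first.
  by apply: sub_all Hx => d /=; lia.
by apply/all_filterP.
Qed.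

Lemma flush_at_rob : [seq d <- rob p | e_idx d < e_idx e] = x.
Proof. exact: older_at. Qed.

Lemma flush_after_rob : [seq d <- rob p | e_idx d < (e_idx e).+1] = rcons x e.
Proof.
rewrite Hp filter_cat /= ltnSn filter_older; last by move=> d; lia.
rewrite filter_none -?cats1 //.
by apply: sub_all Hy => d /=; lia.
Qed.

Lemma modify_at f : rob (modify p (e_idx e) f) = x ++ f e :: y.
Proof.
rewrite /modify /= Hp map_cat /= eqxx; congr (_ ++ _ :: _).
  elim: x Hx => [|d s IH] //= /andP[h /IH->].
  by rewrite ltn_eqF.
elim: y Hy => [|d s IH] //= /andP[h /IH->].
by rewrite gtn_eqF.
Qed.

End Split.

Lemma lookup_split p k e : lookup p k = Some e ->
  exists x y, rob p = x ++ e :: y /\ k = e_idx e.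
Proof.
rewrite /lookup; elim: (rob p) => [|d es IH] //=; case: eqP => [<-|_].
  by case=> ->; exists [::], es.
by case/IH=> x [y [-> ->]]; exists (d :: x), y.
Qed.

Lemma src_valE gts c p x e y r : core gts c p -> rob p = x ++ e :: y ->
  src_val p (e_idx e) r = src c x r.
Proof.
move=> K Hp; rewrite /src_val (older_at (idxs_rob_sorted K) Hp) /src (k_rf K).
elim/last_ind: {Hp} x => [|x d IH] //.
rewrite foldl_rcons IH /writer -cats1 latest_cat /=.
by case: eqP.
Qed.

Lemma src_valsE gts c p x e y srcs vs : core gts c p -> rob p = x ++ e :: y ->
  src_vals p (e_idx e) srcs = Some vs -> srcs_val c x srcs vs.
Proof.
move=> K Hp; rewrite /src_vals; case: ifP => // h [<-].
rewrite /srcs_val -(eq_map (fun r => src_valE r K Hp)).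
elim: srcs h => [|r srcs IH] //= /andP[+ /IH->].
by case: src_val.
Qed.

Lemma bypassE gts c p x e y a : core gts c p -> rob p = x ++ e :: y ->
  find_bypass p (e_idx e) a = bypass c x a.
Proof.
move=> K Hp; rewrite /find_bypass (older_at (idxs_rob_sorted K) Hp).
by rewrite bypass_robE /bypass /base (k_sb K).
Qed.

(* The reorder buffer, from the entry just younger than an executed store to a,
   after the loop of OOO-StEx, and the resulting PC register. *)
Fixpoint killed a es : seq entry :=
  if es is e :: es' then
    match e_ins e with
    | St _ _ _ => if e_addr e == Some a then es else e :: killed a es'
    | Ld _ _ _ =>
        if (e_addr e == Some a) && ~~ is_idle (e_ex e) then
          if is_done (e_ex e) then [::] else set_ex ReEx e :: killed a es'
        else e :: killed a es'
    | _ => e :: killed a es'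
    end
  else [::].

Fixpoint killed_pc a es (pc : PC) : PC :=
  if es is e :: es' then
    match e_ins e with
    | St _ _ _ => if e_addr e == Some a then pc else killed_pc a es' pc
    | Ld _ _ _ =>
        if [&& e_addr e == Some a, ~~ is_idle (e_ex e) & is_done (e_ex e)]
        then e_pc e else killed_pc a es' pc
    | _ => killed_pc a es' pc
    end
  else pc.

(** The induction moves treated entries into [z]. Sortedness makes each lookup by index hit the
    entry at the boundary, and marking it leaves the rest of the precomputed list valid. *)
Lemma kill_ldsE a p z y : sorted ltn [seq e_idx e | e <- rob p] ->
  rob p = z ++ y ->
  let p' := kill_lds p (affected_lds a y) in
  [/\ rob p' = z ++ killed a y, pcr p' = killed_pc a y (pcr p), rf p' = rf p,
      sb p' = sb p & idx_bound p' = idx_bound p].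
Proof.
elim: y p z => [|e y IH] p z hs hp //=.
have skip := IH p (rcons z e) hs _.
rewrite !cat_rcons in skip; have {}skip := skip hp.
case: (e_ins e) => //= [fa srcs dst|fa fd srcs].
  case: eqP => //= _; case hi: (is_idle _) => //=.
  rewrite (lookup_at hs hp); case hd: is_done => /=.
    by rewrite (flush_at_rob hs hp) cats0.
  have hm := modify_at hs hp (set_ex ReEx).
  have := IH (modify p (e_idx e) (set_ex ReEx)) (rcons z (set_ex ReEx e)).
  rewrite hm !cat_rcons; apply=> //.
  by move: hs; rewrite hp !map_cat.
by case: eqP.
Qed.

(** The loop flushes or marks every non-idle load of [a] until it meets a store to [a]. A surviving
    active load is therefore behind such a store, which shields it from the store just executed. *)
Lemma killed_spec a y y0 e2 y1 : killed a y = y0 ++ e2 :: y1 ->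
  is_ld (e_ins e2) -> e_addr e2 = Some a -> e_ex e2 = Exe \/ e_ex e2 = Done ->
  exists u d v, [/\ y0 = u ++ d :: v, exists fa fd srcs, e_ins d = St PC fa fd srcs
    & e_addr d = Some a].
Proof.
move=> + hl ha hx; elim: y y0 => [|e y IH] y0 /=; first by case: y0.
have skip e' : e_ins e' = e_ins e ->
    (is_ld (e_ins e') -> e_addr e' = Some a -> e_ex e' <> Exe /\ e_ex e' <> Done) ->
    e' :: killed a y = y0 ++ e2 :: y1 ->
    exists u d v, [/\ y0 = u ++ d :: v,
      exists fa fd srcs, e_ins d = St PC fa fd srcs & e_addr d = Some a].
  move=> hi hn; case: y0 => [|d y0] /=.
    case=> ee _; subst e2; have [h1 h2] := hn hl ha; by case: hx.
  case=> _ /IH[u [d' [v [-> h1 h2]]]].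
  by exists (d :: u), d', v.
case Ei: (e_ins e) => [op srcs dst|fa srcs dst|fa fd srcs||].
- by apply: skip => //; rewrite Ei.
- case: eqP => [hae|hne] /=; last by apply: skip.
  case hi: is_idle => /=.
    by apply: skip => // _ _; case: (e_ex e) hi.
  case hd: is_done; first by case: (y0).
  by apply: skip.
- case: eqP => [hae|hne] /=; last by apply: skip => //; rewrite Ei.
  case: y0 {skip} => [|d y0] /=; case=> ed _; subst; last first.
    by exists [::], d, y0; split=> //; exists fa, fd, srcs.
  by rewrite Ei in hl.
- by apply: skip => //; rewrite Ei.
- by apply: skip => //; rewrite Ei.
Qed.

Lemma with_tm_id c : with_tm c (x_tm c) = c.
Proof. by case: c. Qed.

Lemma ent_ok_at gts c p x e y : core gts c p -> rob p = x ++ e :: y -> ent_ok c x e.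
Proof. by move=> K; apply: (k_rob K). Qed.

(** Truncating the buffer and turning [Exe] into [ReEx] only weaken what is required of entries, so
    killing loads is sound even before the store is recorded. *)
Lemma core_kill a gts c p z y : core gts c p -> rob p = z ++ y ->
  core gts c (Proc (killed_pc a y (pcr p)) (rf p) (z ++ killed a y) (sb p) (lf p)
                (idx_bound p)).
Proof.
elim: y p z => [|e y IH] p z K hp /=; first exact: core_ext K _ _ _ _ _.
have hstop : core gts c (Proc (pcr p) (rf p) (z ++ e :: y) (sb p) (lf p) (idx_bound p)).
  exact: core_ext K _ _ _ _ _.
have := IH p (rcons z e) K; rewrite !cat_rcons => /(_ hp) hskip.
have he := ent_ok_at K hp.
case Ei: (e_ins e) => [op srcs dst|fa srcs dst|fa fd srcs||] //=; last by case: eqP.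
case: eqP => //= hae; case hi: is_idle => //=.
case: ifP => hd; first by rewrite cats0; apply: core_take K hp _ _ _ _ _.
have hl : is_ld (e_ins e) by rewrite Ei.
set e' := set_ex ReEx e; set p2 := set_rob p (z ++ e' :: y).
case: he => [h1 h2 h3]; rewrite Ei => -[h4 _ _].
have K2 : core gts c p2.
  rewrite -(with_tm_id c).
  apply: (core_upd (x := z) (e := e) (e' := e') (y := y) (z := [::]) K) => //.
  - by rewrite cats0.
  - by move=> b; apply: bypass_entry_ld.
  - by apply: h3; rewrite hd.
  - exact: (k_tm K).
  - rewrite with_tm_id; split=> //=; first by rewrite h3 ?hd.
    by rewrite Ei; split.
  - move=> y0 e2 y1 b _ _ _ _.
    by rewrite /bypass !latest_cat_cons !bypass_entry_ld.
  - by move: (k_chain K); rewrite hp => /chain_cat[].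
by have := IH p2 (rcons z e') K2; rewrite !cat_rcons; apply.
Qed.

(** Holds because stores get address, data and executed state together. *)
Lemma bypass_entry_st gts c p x e y a : core gts c p -> rob p = x ++ e :: y ->
  (exists fa fd srcs, e_ins e = St PC fa fd srcs) -> e_addr e = Some a ->
  exists v, bypass_entry a e = Some (BypassHit v (key e)).
Proof.
move=> K hp [fa [fd [srcs Ei]]] ha.
have [_ _ _] := ent_ok_at K hp; rewrite /bypass_entry Ei => -[ht].
case: is_done; last by rewrite ha.
by case=> vs [_ _ hv _]; exists (fd vs); rewrite ha hv ht eqxx.
Qed.

(** * Pending memory requests *)

Definition req_key (r : request) : nat + Addr :=
  match r with ReqLd k _ => inl k | ReqSt a _ _ => inr a end.

(** The bound on [k] keeps the index of a flushed load from being taken for that of a newly fetched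
    entry. By [q_st], the store deleted by a response is the one that was requested. *)
Record mrb_ok (q : seq request) p : Prop := MrbOk {
  q_ld : forall q1 k a q2, q = q1 ++ ReqLd Val n k a :: q2 ->
    k < idx_bound p /\
    forall x e y, rob p = x ++ e :: y -> e_idx e = k ->
      [/\ is_ld (e_ins e), in_flight (e_ex e) & e_addr e = Some a];
  q_uniq : uniq (map req_key q);
  q_st : forall q1 a v t q2, q = q1 ++ ReqSt a v t :: q2 ->
    exists s1 s2, sb p = s1 ++ SbEntry a v t true :: s2 /\
      ~~ has (fun s => s_addr s == a) s1 }.

(** Entries may disappear, but those that remain stem from old ones. [K] selects the indices with a
    pending request, which exempts a load whose response has just been taken out. *)
Definition flights_kept (K : pred nat) es es' : Prop :=
  forall x e' y, es' = x ++ e' :: y -> exists x2 e y2,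
    [/\ es = x2 ++ e :: y2, e_idx e = e_idx e' &
      K (e_idx e) -> is_ld (e_ins e) -> in_flight (e_ex e) ->
      [/\ is_ld (e_ins e'), in_flight (e_ex e') & e_addr e' = e_addr e]].

Lemma flights_refl K es : flights_kept K es es.
Proof. by move=> x e y ->; exists x, e, y. Qed.

Lemma flights_take K x y : flights_kept K (x ++ y) x.
Proof. by move=> u e v ->; exists u, e, (v ++ y); rewrite -catA. Qed.

Lemma flights_drop K e es : flights_kept K (e :: es) es.
Proof. by move=> u e' v ->; exists (e :: u), e', v. Qed.

Lemma flights_upd (K : pred nat) x e e' y y' : e_idx e' = e_idx e ->
  (K (e_idx e) -> is_ld (e_ins e) -> in_flight (e_ex e) ->
      [/\ is_ld (e_ins e'), in_flight (e_ex e') & e_addr e' = e_addr e]) ->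
  flights_kept K y y' ->
  flights_kept K (x ++ e :: y) (x ++ e' :: y').
Proof.
move=> hi hf hy u d v E.
have [[_ <- _]|[w _ E1]|[w E1 E2]] := split_cases E.
- by exists x, e, y.
- have [x2 [d2 [y2 [-> h1 h2]]]] := hy _ _ _ E1.
  by exists (x ++ e :: x2), d2, y2; rewrite -catA.
- by exists u, d, (w ++ e :: y); rewrite E1 -catA.
Qed.

Lemma flights_killed K a y : flights_kept K y (killed a y).
Proof.
elim: y => [|e y IH] /=; first exact: flights_refl.
have hcons e' : e_idx e' = e_idx e ->
    (is_ld (e_ins e) -> in_flight (e_ex e) ->
      [/\ is_ld (e_ins e'), in_flight (e_ex e') & e_addr e' = e_addr e]) ->
    flights_kept K (e :: y) (e' :: killed a y).
  by move=> h1 h2; apply: (@flights_upd _ [::]).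
case Ei: (e_ins e) => //=; try exact: hcons.
- case: ifP => _; last exact: hcons.
  case: ifP => _; first by move=> [].
  by apply: hcons => // h1 h2; rewrite Ei.
- case: ifP => _; [exact: flights_refl|exact: hcons].
Qed.

Lemma mrb_ok_keep q p p' s : mrb_ok q p ->
  flights_kept (fun k => inl k \in map req_key q) (rob p) (rob p') ->
  idx_bound p <= idx_bound p' -> sb p' = sb p ++ s -> mrb_ok q p'.
Proof.
case=> h1 h2 h3 hf hb hs; split=> //.
- move=> q1 k a q2 Eq; have [hk h] := h1 _ _ _ _ Eq.
  split; first exact: leq_trans hk hb.
  move=> x e' y /hf[x2 [e [y2 [hp hi he]]]] ek.
  have [e1 e2 e3] := h _ _ _ hp (etrans hi ek).
  have kin : inl (e_idx e) \in map req_key q.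
    by rewrite Eq map_cat mem_cat /= inE hi ek eqxx orbT.
  by have [e4 e5 ->] := he kin e1 e2.
- move=> q1 a v t q2 /h3[s1 [s2 [E hn]]].
  by exists s1, (s2 ++ s); rewrite hs E -catA.
Qed.

(** * Silent steps *)

(** No timestamp exceeds the clock, so an entry stamped with the current time dominates all its
    sources. *)
Lemma srcs_tm_now gts c x t srcs : (forall t', x_tm c t' <= gts) ->
  (forall r, w_ts (x_w c) r <= gts) -> x_tm c t = gts -> srcs_tm c x t srcs.
Proof.
move=> h1 h2 h3 r _; rewrite h3 /src_tm leq_max.
by case: writer => [e|]; rewrite ?h1 ?h2.
Qed.

(** Rules that complete an entry stamp it with the current [gts] in [tm']; fetching and address
    computation keep all times. *)
Lemma rule_silent gts c q p p' : core gts c p -> mrb_ok q p ->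
  ooo_rule i P p (Silent _ _ _ _ _) p' ->
  exists tm', core gts (with_tm c tm') p' /\ mrb_ok q p'.
Proof.
move=> K M R; move Ea: (Silent _ _ _ _ _) R => act R.
have upd_tm e t : t <> key e -> upd (x_tm c) (key e) gts t = x_tm c t.
  by rewrite /upd; case: eqP.
have upd_le e t : upd (x_tm c) (key e) gts t <= gts.
  by rewrite /upd; case: eqP => // _; apply: k_tm K _.
have upd_now e : upd (x_tm c) (key e) gts (key e) = gts by rewrite /upd eqxx.
have now e x srcs :
    srcs_tm (with_tm c (upd (x_tm c) (key e) gts)) x (key e) srcs.
  apply: (@srcs_tm_now gts) => /=; [exact: upd_le|exact: k_ts K|exact: upd_now].
case: R Ea K M => // {p p' act}.
- move=> p k npc hk hnpc _ K M; exists (x_tm c); rewrite with_tm_id.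
  set e := new_entry _ _ _ _ _.
  have Eidx es : idxs (sb p) (rcons es e) = rcons (idxs (sb p) es) k.
    by rewrite /idxs map_rcons -rcons_cat.
  have hlt : all (fun j => j < k) (idxs (sb p) (rob p)).
    by apply: sub_all (k_bound K) => j hj; apply: leq_trans hj hk.
  split; last first.
    case: M => h1 h2 h3; split=> //= q1 k' a q2 E; have [hb h] := h1 _ _ _ _ E.
    split=> [|x e' y]; first exact: leq_trans hb (leqW hk).
    rewrite -cats1 -[_ ++ [:: e]]/(rob p ++ e :: [::]) => E'.
    have [[_ <- _]|[[|w0 w] _ //]|[w E1 _]] := split_cases E'; last exact: (h x e' w).
    by rewrite /= => ek; move: hb; rewrite -ek ltnNge hk.
  case: K => k1 k2 k3 k4 k5 k6 k7 k8 k9 k10 k11 k12; split=> //=.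
  + elim: (rob p) (w_pc _) k2 => [|d es IH] pc /=; first by move=> ->.
    by move=> [-> /IH].
  + rewrite Eidx (sorted_pairwise ltn_trans) pairwise_rcons.
    by rewrite -(sorted_pairwise ltn_trans) hlt k6.
  + rewrite Eidx all_rcons ltnSn /=.
    by apply: sub_all hlt => j; apply: ltnW.
  + move=> j; rewrite Eidx mem_rcons inE => -[/orP[/eqP->|h]|h]; apply: k8.
    * by right.
    * by left.
    * by right; apply: leq_trans hk (ltnW h).
  + move=> x e' y; rewrite -cats1 -[_ ++ [:: e]]/(rob p ++ e :: [::]) => E'.
    have [[<- <- _]|[[|w0 w] _ //]|[w E1 _]] := split_cases E'; last exact: (k12 x e' w).
    rewrite /e /new_entry.
    case Ef: (fetch P (pcr p)) hnpc => [op srcs dst|fa srcs dst|fa fd srcs||] hn;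
      by split=> //= _; apply: hn.
- move=> p k e op srcs dst vs npc v hl Ei hx hsrc hop p1 _ K M.
  have [x [y [hp ek]]] := lookup_split hl; subst k.
  have hs := idxs_rob_sorted K.
  have [h1 h2 h3 _] := ent_ok_at K hp.
  have hv : e_val e = None by apply: h3; rewrite hx.
  set e' := nm_done npc v e.
  have hp1 : rob p1 = x ++ e' :: y := modify_at hs hp _.
  exists (upd (x_tm c) (key e) gts).
  have hb a : bypass_entry a e = None by rewrite /bypass_entry Ei.
  have he' : ent_ok (with_tm c (upd (x_tm c) (key e) gts)) x e'.
    split=> //=; first by rewrite Ei.
    rewrite Ei => _; exists vs, v; split=> //; first exact: src_valsE K hp hsrc.
    exact: (now e).
  have hby y0 a : bypass c (x ++ e' :: y0) a = bypass c (x ++ e :: y0) a.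
    by rewrite !bypass_skip // /bypass_entry /= Ei.
  have hfl y' K' : flights_kept K' y y' -> flights_kept K' (rob p) (x ++ e' :: y').
    by rewrite hp; apply: flights_upd; rewrite // Ei.
  case: eqP => hnpc.
    split; last first.
      apply: (mrb_ok_keep (s := [::]) M); rewrite ?hp1 ?cats0 //.
      exact: hfl (@flights_refl _ _).
    apply: (core_upd (x := x) (e := e) (e' := e') (y := y) (z := [::]) K) => //.
    + by rewrite cats0.
    + exact: upd_tm.
    + by rewrite Ei.
    + by move: (k_chain K); rewrite hp => /chain_cat[]; rewrite -hnpc.
  have hf : rob (flush p1 (e_idx e).+1 npc) = x ++ [:: e'].
    rewrite cats1; apply: (@flush_after_rob p1 x y e') => //.
    by rewrite hp1; move: hs; rewrite hp !map_cat.
  split; last first.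
    apply: (mrb_ok_keep (s := [::]) M); rewrite ?hf ?cats0 //; apply: hfl.
    by move=> [].
  apply: (core_upd (x := x) (e := e) (e' := e') (y := [::]) (z := y) K) => //.
    exact: upd_tm.
  by rewrite Ei.
- move=> p k e fa srcs dst vs hl Ei hx hsrc ha _ K M.
  have [x [y [hp ek]]] := lookup_split hl; subst k.
  have hs := idxs_rob_sorted K.
  have [h1 h2 h3 _] := ent_ok_at K hp.
  have hv : e_val e = None by apply: h3; rewrite hx.
  have hb a : bypass_entry a e = None by rewrite /bypass_entry Ei.
  have hp1 := modify_at hs hp (set_addr (fa vs)).
  exists (x_tm c); split; last first.
    apply: (mrb_ok_keep (s := [::]) M); rewrite ?hp1 ?cats0 // hp.
    by apply: (flights_upd _ _ (@flights_refl _ _)); rewrite // hx.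
  apply: (core_upd (x := x) (e := e) (e' := set_addr (fa vs) e) (y := y) (z := [::]) K) => //.
  + by rewrite cats0.
  + exact: k_tm K.
  + split=> //=; rewrite Ei hx; split=> // a [<-].
    by exists vs => //; apply: src_valsE K hp hsrc.
  + by move=> y0 e2 y1 a _ _ _ _; rewrite !bypass_skip // /bypass_entry /= Ei.
  + by rewrite /= hx.
  + by move: (k_chain K); rewrite hp => /chain_cat[].
- move=> p k e fa srcs dst vs a v t hl Ei hx hsrc ha hby _ K M.
  have [x [y [hp ek]]] := lookup_split hl; subst k.
  have hs := idxs_rob_sorted K.
  have := ent_ok_at K hp; case; rewrite Ei => h1 h2 h3 [h4 _ _].
  have hv : e_val e = None by apply: h3; rewrite hx.
  have hb a' : bypass_entry a' e = None by rewrite /bypass_entry Ei.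
  set e' := ld_done v t e.
  have hp1 : rob (modify p (e_idx e) (ld_done v t)) = x ++ e' :: y := modify_at hs hp _.
  rewrite (bypassE _ K hp) in hby.
  exists (upd (x_tm c) (key e) gts); split; last first.
    apply: (mrb_ok_keep (s := [::]) M); rewrite ?hp1 ?cats0 // hp.
    by apply: (flights_upd _ _ (@flights_refl _ _)); rewrite // hx.
  apply: (core_upd (x := x) (e := e) (e' := e') (y := y) (z := [::]) K) => //.
  + by rewrite cats0.
  + exact: upd_tm.
  + split=> //=; rewrite ?Ei //; split=> // _; exists a, v, t; split=> //.
      exact: (now e).
    rewrite /ld_ok -[bypass (with_tm _ _) x a]/(bypass c x a) hby; split=> //=.
    by rewrite /key /= upd_now leq_max upd_le.
  + by move=> y0 e2 y1 a' _ _ _ _; rewrite !bypass_skip // /bypass_entry /= Ei.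
  (* A forwarding load has a store to its address in front of it, so no younger load of that address
     is in the memory case. *)
  + move=> y0 e2 y1 a' t1 t2 _ _ _ _ _ /bypass_top_cat + _ _ /= ha'.
    by move: ha'; rewrite ha => -[<-]; rewrite hby.
  + by move: (k_chain K); rewrite hp => /chain_cat[].
- move=> p k e fa fd srcs vs hl Ei hx hsrc ks _ K M.
  have [x [y [hp ek]]] := lookup_split hl; subst k.
  have hs := idxs_rob_sorted K.
  have := ent_ok_at K hp; case; rewrite Ei hx /= => h1 h2 /(_ isT) hv [ht ha].
  set e' := st_done (fa vs) (fd vs) e.
  set p1 := modify _ _ _.
  have hp1 : rob p1 = x ++ e' :: y := modify_at hs hp _.
  have Eks : ks = affected_lds (fa vs) y by rewrite /ks /find_affected_ld (younger_at hs hp).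
  have hs1 : sorted ltn [seq e_idx d | d <- rob p1].
    by rewrite hp1; move: hs; rewrite hp !map_cat.
  rewrite -cat_rcons in hp1.
  have := kill_ldsE (fa vs) hs1 hp1; rewrite -Eks cat_rcons /= => -[r1 r2 r3 r4 r5].
  have hp' := hp; rewrite -cat_rcons in hp'.
  (* Loads are killed while the store is still unexecuted, and the store is recorded afterwards; the
     resulting buffer is that of the rule. *)
  have := core_kill (fa vs) K hp'; rewrite cat_rcons; set p2 := Proc _ _ _ _ _ _ => K2.
  have hp2 : rob p2 = x ++ e :: killed (fa vs) y by [].
  have hb a' : bypass_entry a' e = None by rewrite /bypass_entry Ei ha.
  exists (upd (x_tm c) (key e) gts); split; last first.
    apply: (mrb_ok_keep (s := [::]) M); rewrite ?r1 ?r4 ?r5 ?cats0 // hp.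
    by apply: (flights_upd _ _ (@flights_killed _ _ _)); rewrite // Ei.
  apply: (core_upd (x := x) (e := e) (e' := e') (y := killed (fa vs) y) (z := [::]) K2) => //.
  + by rewrite cats0.
  + exact: upd_tm.
  + split=> //=; rewrite Ei //.
    split=> //; exists vs; split=> //; first exact: src_valsE K hp hsrc.
    exact: (now e).
  + move=> y0 e2 y1 a E hl2 ha2 hx2.
    rewrite /bypass !latest_cat_cons; case E0: (latest _ y0) => [//|].
    rewrite hb; case: (eqVneq (fa vs) a) => [ea|ne]; last first.
      by rewrite /bypass_entry /= Ei ht (negbTE ne).
    rewrite -ea in ha2 E0.
    (* The shielding store answers the search before it reaches the new one. *)
    have [u [d [v [E1 hd1 hd2]]]] := killed_spec E hl2 ha2 hx2.
    have hp3 : rob p2 = (x ++ e :: u) ++ d :: (v ++ e2 :: y1).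
      by rewrite hp2 E E1 -!catA.
    have [v' hv'] := bypass_entry_st K2 hp3 hd1 hd2.
    by move: E0; rewrite E1 latest_cat_cons hv'; case: latest.
  + by rewrite Ei.
  + by rewrite r2; move: (k_chain K2); rewrite hp2 => /chain_cat[].
Qed.

(** * Retirement *)

Lemma ent_ok_done_ld c x e a t : ent_ok c x e -> is_ld (e_ins e) ->
  is_done (e_ex e) -> e_addr e = Some a -> e_tag e = Some t ->
  exists v, ld_ok c x (key e) a v t.
Proof.
case=> _ _ _; case: (e_ins e) => // fa srcs dst [_ _ h] _ hd ha ht.
have [a' [v' [t' [h1 _ h2 _ h3]]]] := h hd; exists v'; congruence.
Qed.

(** When [base] turns from a hit into top, the processor's own store has been performed. Loads that
    forwarded from it then count as memory reads, which is sound because a processor sees its own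
    store at its creation timestamp. *)
Lemma rob_ok_frame c c' es : rob_ok c es ->
  w_rf (x_w c') = w_rf (x_w c) -> w_ts (x_w c') = w_ts (x_w c) ->
  w_rts (x_w c') = w_rts (x_w c) -> x_tm c' = x_tm c ->
  (forall t1 t2, not_newer (x_over c) t1 t2 -> not_newer (x_over c') t1 t2) ->
  (forall a, base c' a = base c a \/ exists v t,
     [/\ base c a = BypassHit v t, base c' a = BypassTop, x_mem c' a = (v, t)
       & seen_ts i (x_wmem c' a) = x_tm c t]) ->
  (forall a v t k, base c a = BypassTop -> readable c k a v t ->
     readable c' k a v t) ->
  rob_ok c' es.
Proof.
move=> hok hrf hts hrts htm hfr hbase hread x e y def_es.
have he := hok _ _ _ def_es.
apply: (ent_ok_weaken he).
- by move=> r v; rewrite /src /src_tm hrf hts htm leq_max leqnn.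
- by rewrite hrts.
- by rewrite htm.
- move=> _ _ a _ /bypass_topE[h1 h2]; apply/bypass_topE; split=> //.
  by have [->|[v [t []]]] := hbase a; rewrite // h2.
- move=> hl hx a v t ha hv ht; rewrite /ld_ok /bypass hrts htm.
  case El: latest => [[||v' t']|] //.
    by have [? [? [? [_ /bypass_entry_top]]]] := latest_split El.
  have hcoh : coherent c x a t -> coherent c' x a t.
    by move=> h x1 e1 y1 t1 E ? ? ? ?; apply: hfr; apply: h E _ _ _ _.
  have [->|[v' [t' [hb -> hm hs]]]] := hbase a.
    case Eb: base => [||v' t'] // [h1 h2]; split; last exact: hcoh.
    exact: hread.
  rewrite hb; case=> e1 e2 hle; subst v' t'; split.
    by left; rewrite hs htm hrts.
  (* No older entry answers for [a], so an older executed load of [a] took its value from the same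
     buffered store and has the same tag. *)
  move=> x1 e1 y1 t1 E h1 h2 h3 h4; apply: hfr; left.
  have he1 : ent_ok c x1 e1 by apply: (hok _ _ (y1 ++ e :: y)); rewrite def_es E -catA.
  have [v1] := ent_ok_done_ld he1 h1 h2 h3 h4.
  move: El; rewrite /ld_ok /bypass E latest_cat_cons.
  case: latest => //; case: bypass_entry => //; case: latest => // _.
  by rewrite hb => -[].
Qed.

Lemma head_vals c srcs vs : srcs_val c [::] srcs vs -> vs = map (w_rf (x_w c)) srcs.
Proof.
by rewrite /srcs_val; elim: srcs vs => [|r srcs IH] [|v vs] //= [-> /IH->].
Qed.

Lemma head_ats c t srcs : srcs_tm c [::] t srcs ->
  ats (x_w c) srcs <= maxn (x_tm c t) (w_rts (x_w c)).
Proof. by move=> h; apply/bigmax_leqP_seq => r rin _; apply: h. Qed.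

Lemma core_mk gts c p : core gts c p ->
  core gts (Ctx (x_mem c) (x_wmem c) (x_over c) (x_tm c) (x_w c) (sb p)) p.
Proof. by move=> K; rewrite -(k_sb K); case: (c) K. Qed.

Lemma core_retire gts c tm' w' p p' e es :
  core gts c p -> rob p = e :: es -> rob p' = es -> pcr p' = pcr p ->
  idx_bound p' = idx_bound p ->
  let c' := Ctx (x_mem c) (x_wmem c) (x_over c) tm' w' (sb p') in
  w_pc w' = e_npc e -> w_rf w' = rf p' -> w_sb w' = map (wsb tm') (sb p') ->
  sb_own (sb p') -> subseq (idxs (sb p') es) (idxs (sb p) (e :: es)) ->
  (forall r, Some (w_rf w' r) =
     if dst_of (e_ins e) == Some r then e_val e else Some (w_rf (x_w c) r)) ->
  (forall r, w_ts w' r <=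
     maxn (if dst_of (e_ins e) == Some r then x_tm c (key e)
           else w_ts (x_w c) r) (w_rts w')) ->
  w_rts (x_w c) <= w_rts w' -> w_rts w' <= gts ->
  (forall t, tm' t <= maxn (x_tm c t) (w_rts w')) ->
  (forall t, t <> key e -> tm' t = x_tm c t) ->
  (forall a, match bypass_entry a e with
     | None => base c' a = base c a
     | Some Defs.BypassEps => True
     | Some b => base c' a = b
     end) ->
  (forall y0 e2 y1 a v t, es = y0 ++ e2 :: y1 ->
     bypass c (e :: y0) a = BypassTop -> readable c (key e2) a v t ->
     (is_ld (e_ins e) -> is_done (e_ex e) -> e_addr e = Some a ->
      forall t1, e_tag e = Some t1 -> not_newer (x_over c) t1 t) ->
     tm' (key e2) = x_tm c (key e2) ->
     readable c' (key e2) a v t) ->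
  core gts c' p'.
Proof.
move=> K hp hp' hpc hbd c' hwpc hwrf hwsb hown hsub hrf hts hr1 hr2 htm1 htm2 hbase hread.
have hu := k_uniq K; rewrite hp in hu.
split; rewrite ?hp' //.
- by move: (k_chain K); rewrite hp hpc hwpc => -[].
- by apply: (subseq_sorted ltn_trans hsub); rewrite -hp; apply: k_sorted K.
- apply/allP => k /(mem_subseq hsub) hk.
  by move/allP: (k_bound K); rewrite hp hbd; apply.
- move=> k [/(mem_subseq hsub) hk|hk]; apply: (k_unspent K);
    rewrite ?hp -?hbd; [by left|by right].
- move=> r; apply: leq_trans (hts r) _; rewrite geq_max hr2 andbT.
  by case: eqP => _; [apply: k_tm K _|apply: k_ts K _].
- move=> t; apply: leq_trans (htm1 t) _; rewrite geq_max hr2 andbT.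
  exact: k_tm K _.
- apply: (rob_ok_commit (c := c) (e := e)) => //.
    by rewrite -hp; apply: k_rob K.
  by rewrite (k_sb K).
Qed.

Lemma idxs_behead q e es : subseq (idxs q es) (idxs q (e :: es)).
Proof. by rewrite /idxs; apply: cat_subseq (subseq_refl _) (subseq_cons _ _). Qed.

(** The case of Nm and Ld: besides the register write, the only thing to check is that entries
    dropped from the invalidation buffer serve no younger load. *)
Lemma core_retire_write gts c p p' e es dst v T ib' :
  core gts c p -> rob p = e :: es -> rob p' = es -> pcr p' = pcr p ->
  sb p' = sb p -> idx_bound p' = idx_bound p -> rf p' = upd (rf p) dst v ->
  dst_of (e_ins e) = Some dst -> e_val e = Some v ->
  T <= maxn (x_tm c (key e)) (w_rts (x_w c)) ->
  let w' := write_reg (x_w c) (e_npc e) dst v T ib' in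
  let c' := Ctx (x_mem c) (x_wmem c) (x_over c) (x_tm c) w' (sb p') in
  (forall k a2 v2 t2, readable c k a2 v2 t2 ->
     (is_ld (e_ins e) -> is_done (e_ex e) -> e_addr e = Some a2 ->
      forall t1, e_tag e = Some t1 -> not_newer (x_over c) t1 t2) ->
     readable c' k a2 v2 t2) ->
  core gts c' p'.
Proof.
move=> K hp hp' hpc hsb hbd hrf hd hv hT w' c' hread.
have hb a : bypass_entry a e = None.
  by rewrite /bypass_entry; case: (e_ins e) hd.
apply: (core_retire (e := e) K hp) => //=.
- by rewrite hrf (k_rf K).
- by rewrite hsb (k_wsb K).
- by rewrite hsb; apply: k_own K.
- by rewrite hsb; apply: idxs_behead.
- by move=> r; rewrite hd /upd -(inj_eq (@Some_inj _)) eq_sym hv; case: eqP.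
- move=> r; rewrite hd /upd -(inj_eq (@Some_inj _)) eq_sym; case: eqP => // _.
  by rewrite leq_max leqnn.
- exact: k_rts K.
- by move=> t; rewrite leq_max leqnn.
- by move=> a; rewrite hb /base /= hsb (k_sb K).
- by move=> y0 e2 y1 a v2 t2 _ _ h1 h2 _; apply: hread h1 h2.
Qed.

Lemma in_sb_map tm a (q : seq sb_entry) :
  in_sb a (map (wsb tm) q) = has (fun s => s_addr s == a) q.
Proof. by rewrite /in_sb has_map. Qed.

Lemma filter_split (T : Type) (Q : pred T) (s s1 s2 : seq T) z :
  s = s1 ++ z :: s2 -> Q z -> exists r1 r2, filter Q s = r1 ++ z :: r2.
Proof.
move=> -> hz; exists (filter Q s1), (filter Q s2).
by rewrite filter_cat /= hz.
Qed.

(** For the oldest entry the list of older entries is empty, so its invariant speaks only of the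
    WMM-D state and yields the premises of the matching rule. *)
Lemma rule_retire gts c q p ev p' : core gts c p -> mrb_ok q p ->
  (forall a, c_val (x_wmem c a) = (x_mem c a).1) ->
  (forall a, x_over c (x_mem c a).2 = None) ->
  ooo_rule i P p (Retire n ev) p' ->
  exists w' tm', let c' := Ctx (x_mem c) (x_wmem c) (x_over c) tm' w' (sb p') in
    [/\ wmmd_exec i P gts (x_wmem c) (x_w c) ev w', core gts c' p' & mrb_ok q p'].
Proof.
move=> K M Hval Hover R; move Ea: (Retire _ _) R => act R.
have keep p0 p1 e es s : mrb_ok q p0 -> rob p0 = e :: es -> rob p1 = es ->
    idx_bound p1 = idx_bound p0 -> sb p1 = sb p0 ++ s -> mrb_ok q p1.
  move=> M0 h1 h2 h3 h4; apply: (mrb_ok_keep M0) h4; rewrite ?h3 // h1 h2.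
  exact: flights_drop.
have head p0 e es : core gts c p0 -> rob p0 = e :: es ->
    [/\ ent_ok c [::] e, e_pc e = w_pc (x_w c) & e_ins e = fetch P (w_pc (x_w c))].
  move=> K0 h; have he := ent_ok_at K0 (x := [::]) h.
  by move: (k_chain K0); rewrite h => -[<- _]; split=> //; case: he.
case: R Ea K M => // {p p' act}.
- move=> p e es op srcs dst v hp hx Ei hv [->] K M.
  have [he hpc hf] := head _ _ _ K hp.
  have [_ _ _] := he; rewrite Ei hx => -[]// vs [v' [/head_vals hvs hop hv' /head_ats hts]].
  move: hv'; rewrite hv => -[ev']; subst v' vs.
  exists (write_reg (x_w c) (e_npc e) dst v (ats (x_w c) srcs) (w_ib (x_w c))), (x_tm c); split.
  + by rewrite -Ei hpc hf; apply: WmmNm; rewrite -?hf ?Ei // -hpc.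
  + apply: (core_retire_write (p' := Proc _ _ _ _ _ _) K hp) => //; first by rewrite Ei.
  + by apply: (keep _ _ _ _ [::] M hp); rewrite //= cats0.
- move=> p e es fa srcs dst a v hp hx Ei ha hv [->] K M.
  have [he hpc hf] := head _ _ _ K hp.
  have [_ hn _] := he; rewrite Ei hx => -[hvs _ []//].
  move=> a' [v' [t [ha' hv' ht /head_ats hts hl]]].
  move: ha' hv'; rewrite ha hv => -[ea] [ev']; subst a' v'.
  have [vs /head_vals evs efa] := hvs _ ha; subst vs.
  have {}hn : e_npc e = seqpc P (w_pc (x_w c)) by rewrite hn ?Ei // hpc.
  have hd : dst_of (e_ins e) = Some dst by rewrite Ei.
  have hM p1 : rob p1 = es -> idx_bound p1 = idx_bound p -> sb p1 = sb p -> mrb_ok q p1.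
    by move=> h1 h2 h3; apply: (keep _ _ _ _ [::] M hp); rewrite // h3 cats0.
  move: hl; rewrite /ld_ok /bypass /= /base (k_sb K).
  case Eb: bypass_sb => [||v' t'] //.
  + have hno : ~~ in_sb a (w_sb (x_w c)).
      by rewrite (k_wsb K) in_sb_map; apply/bypass_sb_top.
    case=> -[[hm hs]|[b1 [L [U [b2 [hov hib hL hU]]]]]] _.
    * have hvc : v = c_val (x_wmem c a) by rewrite Hval hm.
      have hov : x_over c t = None by have := Hover a; rewrite hm.
      exists (write_reg (x_w c) (e_npc e) dst v
        (maxn (ats (x_w c) srcs) (maxn (w_rts (x_w c)) (seen_ts i (x_wmem c a))))
        (ib_clear a (w_ib (x_w c)))), (x_tm c); split; last exact: hM.
        by rewrite -Ei hpc hf hn {1 2}hvc; 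
          apply: (@WmmLdMem _ _ _ _ _ i P gts (x_wmem c) (x_w c) fa srcs dst a);
          rewrite -?hf.
      apply: (core_retire_write (p' := Proc _ _ _ _ _ _) K hp) => //.
        by rewrite !geq_max hts hs leq_maxr.
      move=> k a2 v2 t2 [h|[b3 [L2 [U2 [b4 [h1 h2 h3 h4]]]]]] hfr; first by left.
      (* The retiring load read the current value; by coherence a younger load of [a] cannot have
         read an overwritten one. *)
      right; have ne : a2 != a.
        apply/eqP => ea; subst a2.
        have := hfr _ _ ha _ ht; rewrite Ei hx => /(_ isT isT).
        by case=> [et|[u1]]; [move: h1; rewrite -et hov|rewrite hov].
      have [r1 [r2 hr]] := filter_split (Q := fun x => ib_addr x != a) h2 ne.
      by exists r1, L2, U2, r2.
    * exists (write_reg (x_w c) (e_npc e) dst v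
        (maxn (ats (x_w c) srcs) (maxn (w_rts (x_w c)) L))
        (ib_clear_before a U (w_ib (x_w c)))), (x_tm c); split; last exact: hM.
        rewrite -Ei hpc hf hn; apply: (@WmmLdIb _ _ _ _ _ i P gts (x_wmem c)
          (x_w c) fa srcs dst a b1 v L U b2); rewrite -?hf //.
        exact: leq_trans hts hU.
      apply: (core_retire_write (p' := Proc _ _ _ _ _ _) K hp) => //.
        by rewrite !geq_max hts hL leq_maxr.
      move=> k a2 v2 t2 [h|[b3 [L2 [U2 [b4 [h1 h2 h3 h4]]]]]] hfr; first by left.
      (* A removed entry holds a value overwritten before the one just read, which coherence forbids
         for younger loads. *)
      right; have ne : ~~ ((a2 == a) && (U2 < U)).
        apply/negP => /andP[/eqP ea hlt]; subst a2.
        have := hfr _ _ ha _ ht; rewrite Ei hx => /(_ isT isT).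
        case=> [et|[u1]]; first by move: h1 hlt; rewrite -et hov => -[->]; rewrite ltnn.
        by rewrite hov => -[<-] /(_ _ h1); rewrite leqNgt hlt.
      have [r1 [r2 hr]] :=
        filter_split (Q := fun x => ~~ ((ib_addr x == a) && (ib_tsU x < U))) h2 ne.
      by exists r1, L2, U2, r2.
  + case=> ev1 et hle; subst v' t'.
    have [q1 [b [q2 [hq hno]]]] := bypass_sb_hit Eb.
    exists (write_reg (x_w c) (e_npc e) dst v
      (maxn (ats (x_w c) srcs) (maxn (w_rts (x_w c)) (x_tm c t))) (w_ib (x_w c))), (x_tm c).
    split; last exact: hM.
      rewrite -Ei hpc hf hn.
      apply: (@WmmLdSb _ _ _ _ _ i P gts (x_wmem c) (x_w c) fa srcs dst a
        (map (wsb (x_tm c)) q1) v (x_tm c t) (map (wsb (x_tm c)) q2));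
        rewrite -?hf //; first by rewrite (k_wsb K) hq map_cat.
      by rewrite in_sb_map.
    apply: (core_retire_write (p' := Proc _ _ _ _ _ _) K hp) => //.
        by rewrite !geq_max hts hle leq_maxr.
- move=> p e es hp hx Ei [->] K M.
  have [[_ hn _ _] hpc hf] := head _ _ _ K hp.
  have {}hn : e_npc e = seqpc P (w_pc (x_w c)) by rewrite hn ?Ei // hpc.
  exists (WProc (seqpc P (w_pc (x_w c))) (w_rf (x_w c)) (w_ts (x_w c)) gts
            (w_sb (x_w c)) [::]), (x_tm c); split.
  + by rewrite hpc hf; apply: WmmRec; rewrite -hf.
  + apply: (core_retire (p' := Proc _ _ _ _ _ _) (e := e) K hp) => //=.
    * exact: k_rf K.
    * exact: k_wsb K.
    * exact: k_own K.
    * exact: idxs_behead.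
    * by move=> r; rewrite Ei.
    * by move=> r; rewrite Ei leq_max leqnn.
    * exact: k_rts K.
    * by move=> t; rewrite leq_max leqnn.
    * by move=> a; rewrite /bypass_entry Ei.
    (* The Reconcile stops the search of every younger load, so none of them depends on the emptied
       buffer. *)
    * move=> y0 e2 y1 a v t _ /bypass_topE[] /=; case: latest => //.
      by rewrite /bypass_entry Ei.
  + by apply: (keep _ _ _ _ [::] M hp); rewrite //= cats0.
- move=> p e es fa fd srcs a v t hp hx Ei ha hv ht [->] K M.
  have [he hpc hf] := head _ _ _ K hp.
  have [_ hn _] := he; rewrite Ei hx ha hv ht /=.
  move=> -[[et] [vs [/head_vals evs [ea] [ev'] /head_ats hts]]].
  subst vs; have {}hn : e_npc e = seqpc P (w_pc (x_w c)) by rewrite hn ?Ei // hpc.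
  (* From now on the tag carries the creation timestamp of WMM-D instead of the execution time. *)
  set T := ats (x_w c) srcs; set tm' := upd (x_tm c) (key e) T.
  have htm' t' : t' <> key e -> tm' t' = x_tm c t' by rewrite /tm' /upd; case: eqP.
  exists (WProc (seqpc P (w_pc (x_w c))) (w_rf (x_w c)) (w_ts (x_w c)) (w_rts (x_w c))
         (rcons (w_sb (x_w c)) (WSb a v T)) (ib_clear a (w_ib (x_w c)))), tm'; split.
  + by rewrite -Ei hpc hf; 
      apply: (@WmmSt _ _ _ _ _ i P gts (x_wmem c) (x_w c) fa fd srcs a v);
      rewrite -?hf.
  + apply: (core_retire (p' := Proc _ _ _ _ _ _) (e := e) K hp) => //=.
    * exact: k_rf K.
    * rewrite map_rcons (k_wsb K); congr rcons; last first.
        by rewrite /wsb /= et /tm' /upd eqxx.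
      apply: esym; apply: (map_wsb (e := e) (k_own K)) => //.
      have := k_uniq K; rewrite hp /idxs cat_uniq => /and3P[_ /hasPn + _].
      by apply; rewrite /= inE eqxx.
    * by rewrite /sb_own all_rcons /= et eqxx; apply: k_own K.
    * by rewrite /idxs map_rcons cat_rcons /= et subseq_refl.
    * by move=> r; rewrite Ei.
    * by move=> r; rewrite Ei leq_max leqnn.
    * exact: k_rts K.
    * by move=> t'; rewrite /tm' /upd; case: eqP => [->//|_]; rewrite leq_max leqnn.
    * move=> b; rewrite /base /bypass_entry Ei ha hv ht /= rev_rcons /= (k_sb K).
      by case: eqP.
    * move=> y0 e2 y1 b v2 t2 _ /bypass_topE[] /=; case: latest => // hb _.
      (* A younger load of [a] would find the retiring store, hence would not be in the memory
         case. *)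
      have ne : b != a.
        by apply/eqP => eb; move: hb; rewrite eb /bypass_entry Ei ha hv ht eqxx.
      move=> + _ hk; case=> [[h1 h2]|[b3 [L2 [U2 [b4 [h1 h2 h3 h4]]]]]].
        by left; rewrite /= hk.
      have [r1 [r2 hr]] := filter_split (Q := fun x => ib_addr x != a) h2 ne.
      by right; exists r1, L2, U2, r2; rewrite /= hk.
  + by apply: (keep _ _ _ _ [:: SbEntry a v t false] M hp); rewrite //= cats1.
- move=> p e es hp Ei hsb [->] K M.
  have [[_ hn _ _] hpc hf] := head _ _ _ K hp.
  have {}hn : e_npc e = seqpc P (w_pc (x_w c)) by rewrite hn ?Ei // hpc.
  exists (WProc (seqpc P (w_pc (x_w c))) (w_rf (x_w c)) (w_ts (x_w c)) (w_rts (x_w c))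
            (w_sb (x_w c)) (w_ib (x_w c))), (x_tm c); split.
  + by rewrite hpc hf; apply: WmmCom; rewrite -?hf // (k_wsb K) hsb.
  + apply: (core_retire (p' := Proc _ _ _ _ _ _) (e := e) K hp) => //=.
    * exact: k_rf K.
    * exact: k_wsb K.
    * exact: k_own K.
    * exact: idxs_behead.
    * by move=> r; rewrite Ei.
    * by move=> r; rewrite Ei leq_max leqnn.
    * exact: k_rts K.
    * by move=> t; rewrite leq_max leqnn.
    * by move=> a; rewrite /bypass_entry Ei /base /= (k_sb K).
  + by apply: (keep _ _ _ _ [::] M hp); rewrite //= cats0.
Qed.

(** * Requests to the memory and load responses *)

Lemma key_split_ld k (q : seq request) : inl k \in map req_key q ->
  exists q1 a q2, q = q1 ++ ReqLd Val n k a :: q2.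
Proof.
elim: q => [|r q IH] //=; rewrite inE => /orP[|/IH[q1 [a [q2 ->]]]].
  by case: r => [k' a|a v t] //= /eqP[->]; exists [::], a, q.
by exists (r :: q1), a, q2.
Qed.

Lemma key_split_st a (q : seq request) : inr a \in map req_key q ->
  exists q1 v t q2, q = q1 ++ ReqSt a v t :: q2.
Proof.
elim: q => [|r q IH] //=; rewrite inE => /orP[|/IH[q1 [v [t [q2 ->]]]]].
  by case: r => [k' a'|a' v t] //= /eqP[->]; exists [::], v, t, q.
by exists (r :: q1), v, t, q2.
Qed.

Lemma mrb_ok_rcons q r p : mrb_ok q p -> req_key r \notin map req_key q ->
  match r with
  | ReqLd k a => k < idx_bound p /\
      forall x e y, rob p = x ++ e :: y -> e_idx e = k ->
      [/\ is_ld (e_ins e), in_flight (e_ex e) & e_addr e = Some a]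
  | ReqSt a v t => exists s1 s2, sb p = s1 ++ SbEntry a v t true :: s2 /\
      ~~ has (fun s => s_addr s == a) s1
  end -> mrb_ok (rcons q r) p.
Proof.
move=> [h1 h2 h3] hn hr; rewrite -cats1; split.
- move=> q1 k a q2 E; have [[_ er _]|[[|? ?] _ //]|[w E1 _]] := split_cases E.
    by move: hr; rewrite er.
  exact: h1 E1.
- by rewrite map_cat uniq_catC /= hn h2.
- move=> q1 a v t q2 E; have [[_ er _]|[[|? ?] _ //]|[w E1 _]] := split_cases E.
    by move: hr; rewrite er.
  exact: h3 E1.
Qed.

Lemma mrb_ok_rem q1 r q2 p : mrb_ok (q1 ++ r :: q2) p ->
  mrb_ok (q1 ++ q2) p /\ req_key r \notin map req_key (q1 ++ q2).
Proof.
move=> [h1 h2 h3]; split; last first.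
  move: h2; rewrite !map_cat uniq_catC /= mem_cat negb_or => /andP[+ _].
  by rewrite !mem_cat orbC negb_or.
have hs r' u v : q1 ++ q2 = u ++ r' :: v -> exists u' v', q1 ++ r :: q2 = u' ++ r' :: v'.
  elim: q1 u {h1 h2 h3} => [|z q1 IH] u /=.
    by move=> ->; exists (r :: u), v.
  case: u => [|z' u] /= [-> E]; first by exists [::], (q1 ++ r :: q2).
  by have [u' [v' ->]] := IH _ E; exists (z' :: u'), v'.
split.
- by move=> u k a v /hs[u' [v' /h1]].
- move: h2; rewrite !map_cat !cat_uniq /= => /and3P[-> + /andP[_ ->]].
  by rewrite negb_or => /andP[_ ->].
- by move=> u a v t w /hs[u' [v' /h3]].
Qed.

(** OOO-StReq changes only the issue bit, which forwarding does not read. *)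
Definition strip (s : sb_entry) := SbEntry (s_addr s) (s_val s) (s_tag s) false.

Lemma bypass_sb_strip a q : bypass_sb a (map strip q) = bypass_sb a q.
Proof. by elim: q => [|s q IH] //=; rewrite IH. Qed.

Lemma rule_call gts c q r p p' : core gts c p -> mrb_ok q p ->
  ooo_rule i P p (Call Reg PC r) p' ->
  exists tm', core gts (Ctx (x_mem c) (x_wmem c) (x_over c) tm' (x_w c) (sb p')) p' /\
    mrb_ok (rcons q r) p'.
Proof.
move=> K M R; move Ea: (Call _ _ _) R => act R.
case: R Ea K M => // {p p' act}.
- move=> p k e fa srcs dst vs a hl Ei hx hsrc ha hby hlf [->] K M.
  have [x [y [hp ek]]] := lookup_split hl; subst k.
  have hs := idxs_rob_sorted K.
  have := ent_ok_at K hp; case; rewrite Ei => h1 h2 h3 [h4 _ _].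
  have hv : e_val e = None by apply: h3; rewrite hx.
  have hb a' : bypass_entry a' e = None by rewrite /bypass_entry Ei.
  set e' := set_ex Exe e; set p1 := modify _ _ _.
  have hp1 : rob p1 = x ++ e' :: y := modify_at hs hp _.
  rewrite (bypassE _ K hp) in hby.
  have hidx : e_idx e < idx_bound p.
    by move/allP: (k_bound K); apply; rewrite hp /idxs map_cat !mem_cat /= inE eqxx !orbT.
  exists (x_tm c); split; last first.
    apply: mrb_ok_rcons; rewrite /=.
    + apply: (mrb_ok_keep (s := [::]) M); rewrite ?hp1 ?cats0 // hp.
      by apply: (flights_upd _ _ (@flights_refl _ _)); rewrite // hx.
    (* A pending request for this index would make the entry in flight, but it is idle. *)
    + apply/negP => /key_split_ld[q1 [a' [q2 /(q_ld M)[_ h]]]].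
      by have [] := h _ _ _ hp erefl; rewrite hx.
    + have hs1 : sorted ltn [seq e_idx d | d <- rob p1].
        by rewrite hp1; move: hs; rewrite hp !map_cat.
      split=> // x1 e1 y1 h ei; have := @lookup_at p1 x1 y1 e1 hs1 h.
      rewrite ei (@lookup_at p1 x y e' hs1 hp1) => -[<-].
      by rewrite /= Ei.
  apply: (@core_mk _ c); rewrite -(with_tm_id c).
  apply: (core_upd (x := x) (e := e) (e' := e') (y := y) (z := [::]) K) => //.
  + by rewrite cats0.
  + exact: k_tm K.
  + split=> //=; rewrite ?Ei //; split=> // _ a' ha'.
    by move: ha'; rewrite ha => -[<-].
  + by move=> y0 e2 y1 a' _ _ _ _; rewrite !bypass_skip // /bypass_entry /= Ei.
  + by move: (k_chain K); rewrite hp => /chain_cat[].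
- move=> p s1 a v t s2 hsb hno [->] K M.
  (* The oldest store to [a] is not issued, so no request to [a] can be pending. *)
  have hsplit u v' t' s3 : sb p = u ++ SbEntry a v' t' true :: s3 ->
      ~~ has (fun s => s_addr s == a) u -> False.
    rewrite hsb => E hn; have [[_ [] //]|[z E1 _]|[z E1 _]] := split_cases E.
      by move: hn; rewrite E1 has_cat /= eqxx orbT.
    by move: hno; rewrite E1 has_cat /= eqxx orbT.
  exists (x_tm c); split; last first.
    apply: mrb_ok_rcons; rewrite /=; last by exists s1, s2.
      case: (M) => h1 h2 h3; split=> //= q1 b v' t' q2 E.
      have [u [s3 [E2 hn]]] := h3 _ _ _ _ _ E.
      have := E2; rewrite hsb => E3.
      have [[_ [] //]|[z e1 e2]|[z e1 e2]] := split_cases E3.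
        exists (s1 ++ SbEntry a v t true :: z), s3; rewrite e2 -catA; split=> //.
        by move: hn; rewrite e1 !has_cat.
      by exists u, (z ++ SbEntry a v t true :: s2); rewrite e1 -catA.
    apply/negP => /key_split_st[q1 [v' [t' [q2 /(q_st M)[u [s3 [E hn]]]]]]].
    exact: hsplit E hn.
  have hi es : idxs (s1 ++ SbEntry a v t true :: s2) es = idxs (sb p) es.
    by rewrite /idxs hsb !map_cat.
  have K1 := core_mk K; case: K1 => k1 k2 k3 k4 k5 k6 k7 k8 k9 k10 k11 k12.
  split; rewrite /= ?hi //.
  + by rewrite k4 /= hsb !map_cat.
  + by move: k5; rewrite hsb /sb_own !all_cat.
  + apply: (rob_ok_frame k12) => //= b; left; rewrite /base /= hsb.
    by rewrite -[LHS]bypass_sb_strip -[RHS]bypass_sb_strip !map_rev !map_cat.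
Qed.

Lemma stale_ld_some a t y k : stale_ld a t y = Some k ->
  exists y0 e y1, [/\ y = y0 ++ e :: y1, e_idx e = k & stale_ld a t y0 = None].
Proof.
elim: y => [|e y IH] //=.
have skip : stale_ld a t y = Some k ->
    (forall y0, stale_ld a t y0 = None -> stale_ld a t (e :: y0) = None) ->
    exists y0 e' y1, [/\ e :: y = y0 ++ e' :: y1, e_idx e' = k & stale_ld a t y0 = None].
  by move=> /IH[y0 [e' [y1 [-> h1 h2]]]] h; exists (e :: y0), e', y1; split=> //; apply: h.
case Ei: (e_ins e) => //=.
- by move/skip; apply=> y0 h /=; rewrite Ei.
- case: ifP => hc; first by case=> <-; exists [::], e, y.
  by move/skip; apply=> y0 h /=; rewrite Ei hc.
- case: ifP => hc // /skip; apply=> y0 h /=; by rewrite Ei hc.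
- by move/skip; apply=> y0 h /=; rewrite Ei.
- by move/skip; apply=> y0 h /=; rewrite Ei.
Qed.

(** Describes what the flush of respLd leaves: younger executed loads of [a] have the new tag or are
    shielded by a store to [a]. *)
Lemma stale_ld_none a t u e v : stale_ld a t (u ++ e :: v) = None ->
  is_ld (e_ins e) -> is_done (e_ex e) -> e_addr e = Some a ->
  e_tag e = Some t \/ exists u1 d u2, [/\ u = u1 ++ d :: u2,
    exists fa fd srcs, e_ins d = St PC fa fd srcs & e_addr d = Some a].
Proof.
elim: u => [|d u IH] /=.
  case: (e_ins e) => // fa srcs dst hst _ hd ha; left; move: hst.
  by rewrite hd ha eqxx /=; case: eqP.
have skip : stale_ld a t (u ++ e :: v) = None -> is_ld (e_ins e) -> is_done (e_ex e) ->
    e_addr e = Some a -> e_tag e = Some t \/ exists u1 d' u2, [/\ d :: u = u1 ++ d' :: u2,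
    exists fa fd srcs, e_ins d' = St PC fa fd srcs & e_addr d' = Some a].
  move=> h1 h2 h3 h4; have [|[u1 [d' [u2 [-> h5 h6]]]]] := IH h1 h2 h3 h4; first by left.
  by right; exists (d :: u1), d', u2.
case Ei: (e_ins d) => [op srcs dst|fa srcs dst|fa fd srcs||] //=.
- by case: ifP.
- case: eqP => // ha _ _ _ _; right; exists [::], d, u; split=> //.
  by exists fa, fd, srcs.
Qed.

(** The value is current when it arrives, so stamping the load with [gts] makes it readable.
    Coherence with older loads is automatic, and with younger ones it is ensured by the flush of
    stale loads. *)
Lemma resp_ld_ok gts c q1 q2 k a p v t :
  core gts c p -> mrb_ok (q1 ++ ReqLd Val n k a :: q2) p ->
  x_mem c a = (v, t) -> x_over c t = None -> seen_ts i (x_wmem c a) <= gts ->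
  exists tm', core gts (with_tm c tm') (resp_ld p k v t) /\
    mrb_ok (q1 ++ q2) (resp_ld p k v t).
Proof.
move=> K M hm hov hseen; have [M' hn] := mrb_ok_rem M.
rewrite /resp_ld; case: ifP => _.
  exists (x_tm c); rewrite with_tm_id; split; first exact: core_ext K _ _ _ _ _.
  apply: (mrb_ok_keep (s := [::]) M') => //=; last by rewrite cats0.
  exact: flights_refl.
case El: lookup => [e|]; last by exists (x_tm c); rewrite with_tm_id.
have [x [y [hp ek]]] := lookup_split El; subst k.
have hs := idxs_rob_sorted K.
have [_ /(_ _ _ _ hp erefl)[hl hf ha]] := q_ld M erefl.
have := ent_ok_at K hp; case=> h1 h2 h3 h4.
have hv : e_val e = None by apply: h3; case: (e_ex e) hf.
have hb a' : bypass_entry a' e = None by apply: bypass_entry_ld.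
have hM p' e' y' : e_idx e' = e_idx e ->
    flights_kept (fun k => inl k \in map req_key (q1 ++ q2)) y y' ->
    rob p' = x ++ e' :: y' -> sb p' = sb p -> idx_bound p' = idx_bound p ->
    mrb_ok (q1 ++ q2) p'.
  move=> ei hy hp' hsb hbd; apply: (mrb_ok_keep (s := [::]) M'); rewrite ?hsb ?hbd ?cats0 //.
  rewrite hp hp'; apply: flights_upd => // hin; by move: hn; rewrite /= hin.
case Ex: (e_ex e) hf => // _.
- rewrite ha; set e' := ld_done v t e; set p1 := modify _ _ _.
  have hp1 : rob p1 = x ++ e' :: y := modify_at hs hp _.
  have hs1 : sorted ltn [seq e_idx d | d <- rob p1].
    by rewrite hp1; move: hs; rewrite hp !map_cat.
  have hexe : bypass c x a = BypassTop.
    by move: h4; case: (e_ins e) hl => // fa srcs dst _ [_ h _]; apply: h.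
  set tm' := upd (x_tm c) (key e) gts.
  have htm t' : t' <> key e -> tm' t' = x_tm c t' by rewrite /tm' /upd; case: eqP.
  have hle t' : tm' t' <= gts.
    by rewrite /tm' /upd; case: eqP => // _; apply: k_tm K _.
  have hnow : tm' (key e) = gts by rewrite /tm' /upd eqxx.
  have he' : ent_ok (with_tm c tm') x e'.
    split=> //=; move: h4; case: (e_ins e) hl => // fa srcs dst _ [h4 _ _]; split=> // _.
    exists a, v, t; split=> //.
      by apply: (@srcs_tm_now gts) => //=; apply: k_ts K.
    rewrite /ld_ok -[bypass (with_tm _ _) x a]/(bypass c x a) hexe; split.
      by left; split=> //=; rewrite -[key e']/(key e) hnow leq_max hseen.
    move=> x1 e1 y1 t1 E g1 g2 g3 g4.
    have he1 : ent_ok c x1 e1.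
      by apply: (k_rob K (y := y1 ++ e :: y)); rewrite hp E -catA.
    have [v1] := ent_ok_done_ld he1 g1 g2 g3 g4.
    rewrite /ld_ok; rewrite E in hexe; rewrite (bypass_top_cat hexe).
    (* The older load read either the same current store or one overwritten at [U], whereas [t] has
       not been overwritten. *)
    case=> -[[hm1 _]|[b1 [L [U [b2 [hov1 _ _ _]]]]]] _ /=.
      by left; move: hm1; rewrite hm => -[].
    by right; exists U => //= u2; rewrite hov.
  (* Treats both outcomes of the stale search: [z] is the flushed part, empty when nothing is
     stale. *)
  have main p' y' z : y = y' ++ z -> stale_ld a t y' = None ->
      chain (e_npc e') y' (pcr p') -> rf p' = rf p -> rob p' = x ++ e' :: y' ->
      sb p' = sb p -> idx_bound p' = idx_bound p ->
      exists tm', core gts (with_tm c tm') p' /\ mrb_ok (q1 ++ q2) p'.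
    move=> hy hst hch g1 g2 g3 g4; exists tm'; split; last first.
      by apply: hM (g2) _ _; rewrite // hy; apply: flights_take.
    apply: (core_upd (x := x) (e := e) (e' := e') (y := y') (z := z) K) => //.
    + by rewrite -hy.
    + by move=> y0 e2 y1 b _ _ _ _; rewrite !bypass_skip // bypass_entry_ld.
    + move=> y0 e2 y1 b t1 t2 E g5 g6 g7 g8 hby _ _ /=; rewrite ha => -[eb] [<-]; subst b.
      left; rewrite E in hst.
      have hd2 : is_done (e_ex e2) by rewrite g6.
      (* A shielding store would contradict that the search of [e2] reaches memory. *)
      have [|] := stale_ld_none hst g5 hd2 g7; first by rewrite g8 => -[].
      case=> u1 [d [u2 [E2 g9 g10]]].
      have hp2 : rob p = (x ++ e :: u1) ++ d :: (u2 ++ e2 :: y1 ++ z).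
        by rewrite hp hy E E2 -!catA.
      have [v' hv'] := bypass_entry_st K hp2 g9 g10.
      move/bypass_topE: hby => [+ _]; rewrite E2 latest_cat_cons latest_cat_cons hv'.
      by case: latest.
  have hch : chain (e_npc e) y (pcr p).
    by move: (k_chain K); rewrite hp => /chain_cat[].
  case Est: find_stale_ld => [k'|].
    have := Est; rewrite /find_stale_ld (@younger_at p1 x y e' hs1 hp1).
    case/stale_ld_some=> y0 [e3 [y1 [hy ek' hst]]].
    have hp2 : rob p1 = (x ++ e' :: y0) ++ e3 :: y1 by rewrite hp1 hy -catA.
    rewrite /flush_at -ek' (lookup_at hs1 hp2).
    apply: (main _ y0 (e3 :: y1)) => //.
      by move: hch; rewrite hy => /chain_cat[].
    exact: flush_at_rob hs1 hp2.
  apply: (main _ y [::]) => //; first by rewrite cats0.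
  by move: Est; rewrite /find_stale_ld (@younger_at p1 x y e' hs1 hp1).
- have hp1 := modify_at hs hp (set_ex Idle).
  exists (x_tm c); split; last first.
    by apply: hM hp1 _ _ => //; apply: flights_refl.
  apply: (core_upd (x := x) (e := e) (e' := set_ex Idle e) (y := y) (z := [::]) K) => //.
  + by rewrite cats0.
  + exact: k_tm K.
  + split=> //=; move: h4; case: (e_ins e) hl => // fa srcs dst _ [h4 _ _]; by split.
  + by move=> y0 e2 y1 b _ _ _ _; rewrite !bypass_skip // bypass_entry_ld.
  + by move: (k_chain K); rewrite hp => /chain_cat[].
Qed.

(** * Stores performed by the memory *)

(** The new overwriting time is the largest so far, so the order of the earlier ones is kept. *)
Lemma not_newer_overwrite over t0 gts t1 t2 : over t0 = None ->
  (forall t u, over t = Some u -> u <= gts) ->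
  not_newer over t1 t2 -> not_newer (upd over t0 (Some gts)) t1 t2.
Proof.
move=> h0 hle [->|[u1 h1 h2]]; [by left|right; exists u1].
  by rewrite /upd; case: eqP => // et; move: h1; rewrite et h0.
by move=> u2; rewrite /upd; case: eqP => [_ [<-]|_ /h2]; [apply: hle h1|].
Qed.

(** By [m_inj], recording that the value of one address is overwritten leaves the other current
    values marked as current. *)
Record mem_ok gts (m : Addr -> Val * tag) (wm : Addr -> wmem_cell Val n)
    (over : tag -> option nat) : Prop := MemOk {
  m_val : forall a, c_val (wm a) = (m a).1;
  m_over : forall a, over (m a).2 = None;
  m_inj : forall a b, (m a).2 = (m b).2 -> a = b;
  m_le : forall t u, over t = Some u -> u <= gts;
  m_seen : forall j a, seen_ts j (wm a) <= gts }.

Section Dequeue.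
Variables (gts : nat) (m : Addr -> Val * tag) (wm : Addr -> wmem_cell Val n).
Variables (over : tag -> option nat) (a : Addr) (v : Val) (t : tag).
Variables (j : 'I_n) (sts : nat).
Hypotheses (Hm : mem_ok gts m wm over) (Hsts : sts <= gts).

Let m' := upd m a (v, t).
Let wm' := upd wm a (WCell v (Some j) sts gts.+1).
Let over' := upd over (m a).2 (Some gts).

Lemma mem_ok_store : over t = None -> (forall b, (m b).2 <> t) ->
  mem_ok gts.+1 m' wm' over'.
Proof.
case: Hm => h1 h2 h3 h4 h5 ht1 ht2; split.
- by move=> b; rewrite /m' /wm' /upd; case: eqP.
- move=> b; rewrite /m' /over' /upd; case: (b =P a) => [_|ne] /=.
    by case: eqP => // et; case: (ht2 a).
  by case: eqP => // /h3.
- move=> b d; rewrite /m' /upd; case: (b =P a) => [->|nb]; case: (d =P a) => [->|nd] //=.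
  + by move/esym/ht2.
  + by move/ht2.
  + exact: h3.
- move=> t' u; rewrite /over' /upd; case: eqP => [_ [<-]//|_ /h4].
  exact: leqW.
- move=> k b; rewrite /wm' /upd; case: eqP => _; last exact: leqW.
  by rewrite /seen_ts /=; case: eqP => // _; apply: leqW.
Qed.

Lemma unspent_store c c' t' : x_mem c = m -> x_over c = over -> x_mem c' = m' ->
  x_over c' = over' -> unspent c t' -> t' <> t -> unspent c' t'.
Proof.
rewrite /unspent => -> -> -> -> [h1 h2] ht; split.
  by rewrite /over' /upd; case: eqP => // et; case: (h2 a).
by move=> b; rewrite /m' /upd; case: eqP => // _ /esym.
Qed.

Lemma readable_store_neq c w' q' b v' t' k : x_mem c = m -> x_wmem c = wm ->
  x_over c = over -> b <> a ->
  w_rts w' = w_rts (x_w c) -> (forall b1 x b2, w_ib (x_w c) = b1 ++ x :: b2 ->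
    exists b1 b2, w_ib w' = b1 ++ x :: b2) ->
  readable c k b v' t' -> readable (Ctx m' wm' over' (x_tm c) w' q') k b v' t'.
Proof.
move=> e1 e2 e3 ne er hib [[h1 h2]|[b1 [L [U [b2 [h1 h2 h3 h4]]]]]].
  left; rewrite /= er /m' /wm' /upd; case: eqP => // _.
  by rewrite -e1 -e2.
have [b1' [b2' h5]] := hib _ _ _ h2.
right; exists b1', L, U, b2'; rewrite /= er; split=> //.
rewrite /over' /upd; case: eqP => [et|_]; last by rewrite -e3.
by move: h1; rewrite e3 et (m_over Hm).
Qed.

(** A load that relied on the overwritten cell finds the old value in the invalidation buffer. The
    insertion takes place because such a load has no store to [a] in front of it in the store
    buffer. *)
Lemma core_deq_other tm w p : core gts (Ctx m wm over tm w (sb p)) p ->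
  j <> i -> (exists k, t = inr (j, k)) ->
  core gts.+1 (Ctx m' wm' over' tm (invalidate gts a (wm a) i w) (sb p)) p.
Proof.
move=> K ne [k0 et]; case: (K) => k1 k2 k3 k4 k5 k6 k7 k8 k9 k10 k11 k12.
have [e1 [e2 [e3 [e4 e5]]]] : let w' := invalidate gts a (wm a) i w in
    w_pc w' = w_pc w /\ w_rf w' = w_rf w /\ w_ts w' = w_ts w /\
    w_rts w' = w_rts w /\ w_sb w' = w_sb w.
  by rewrite /invalidate; case: ifP.
split; rewrite /= ?e1 ?e2 ?e3 ?e4 ?e5 //.
- move=> k /k8 hk; apply: (unspent_store _ _ _ _ hk) => //; rewrite et => -[ej _].
  exact: ne.
- by move=> r; apply/leqW/k9.
- exact: leqW.
- by move=> t'; apply/leqW/k11.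
- apply: (rob_ok_frame k12) => //=.
  + by move=> t1 t2; apply: not_newer_overwrite; [apply: (m_over Hm)|apply: (m_le Hm)].
  + by move=> b; left.
  + move=> b v' t' k hb.
    have hib b1 x b2 : w_ib w = b1 ++ x :: b2 ->
        exists b1 b2, w_ib (invalidate gts a (wm a) i w) = b1 ++ x :: b2.
      rewrite /invalidate => E; case: ifP => _; first by exists b1, b2.
      exists b1, (rcons b2 (Ib a (c_val (wm a)) (seen_ts i (wm a)) gts)).
      by rewrite /= E rcons_cat.
    case: (b =P a) => [eb|nb]; last exact: readable_store_neq.
    subst b; case=> [[h1 h2]|[b1 [L [U [b2 [h1 h2 h3 h4]]]]]]; right; last first.
      have [b1' [b2' h5]] := hib _ _ _ h2.
      exists b1', L, U, b2'; rewrite /= e4; split=> //.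
      rewrite /over' /upd; case: eqP => // et'.
      by move: h1; rewrite /= et' (m_over Hm).
    have hno : in_sb a (w_sb w) = false.
      by rewrite k4 in_sb_map; apply/negbTE/bypass_sb_top.
    (* The entry just inserted: its lower bound is the old visibility time, and its upper bound is
       the clock, which no execution time or rts exceeds. *)
    exists (w_ib w), (seen_ts i (wm a)), gts, [::]; rewrite /= e4; split=> //.
    * by rewrite /over' /upd; rewrite /= in h1; rewrite h1 eqxx.
    * by rewrite /invalidate hno /= (m_val Hm) cats1; rewrite /= in h1; rewrite h1.
    * by rewrite geq_max (k11 (k)) k10.
Qed.

End Dequeue.

(** The performed request is for the oldest buffered store to [a], the one that WMM-D dequeues, and
    [tm t] is its creation timestamp. *)
Lemma deq_own gts m wm over tm w q1 q2 a v t p :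
  let c := Ctx m wm over tm w (sb p) in let p' := resp_st p a in
  core gts c p -> mrb_ok (q1 ++ ReqSt a v t :: q2) p -> mem_ok gts m wm over ->
  exists s1 s2,
    [/\ w_sb w = map (wsb tm) s1 ++ WSb a v (tm t) :: map (wsb tm) s2,
        ~~ in_sb a (map (wsb tm) s1),
        core gts.+1 (Ctx (upd m a (v, t))
          (upd wm a (WCell v (Some i) (tm t) gts.+1)) (upd over (m a).2 (Some gts))
          tm (wset_sb w (map (wsb tm) s1 ++ map (wsb tm) s2)) (sb p')) p',
        mrb_ok (q1 ++ q2) p'
      & unspent c t /\ exists k, t = inr (i, k)].
Proof.
move=> c p' K M Hm; have [M' hn] := mrb_ok_rem M.
have [s1 [s2 [hsb hno]]] := q_st M erefl.
have hsb' : sb p' = s1 ++ s2.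
  rewrite /p' /resp_st /= /rem_first hsb find_cat (negbTE hno) /= eqxx addn0.
  rewrite take_size_cat // drop_cat ltnNge leqnSn /= subSnn /=.
  by rewrite drop0.
have hu := k_uniq K.
case: (K) => k1 k2 k3 k4 k5 k6 k7 k8 k9 k10 k11 k12.
have et : t = inr (i, tag_idx t).
  by move: k5; rewrite hsb /sb_own all_cat /= => /and3P[_ /eqP].
have hsub : subseq (idxs (s1 ++ s2) (rob p)) (idxs (sb p) (rob p)).
  rewrite /idxs hsb; apply: cat_subseq (subseq_refl _).
  by rewrite !map_cat; apply: cat_subseq (subseq_refl _) (subseq_cons _ _).
have hnot : tag_idx t \notin idxs (s1 ++ s2) (rob p).
  move: hu; rewrite /idxs hsb !map_cat /= -!catA uniq_catC /= => /andP[+ _].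
  by rewrite !mem_cat !negb_or => /andP[/andP[h1 h2] h3]; rewrite h1 h2 h3.
have tin : tag_idx t \in idxs (sb p) (rob p).
  by rewrite /idxs hsb !map_cat !mem_cat /= inE eqxx !orbT.
have ht : unspent c t by rewrite et; apply: k8; left.
exists s1, s2; split; last by split=> //; exists (tag_idx t).
- by rewrite k4 hsb map_cat.
- by rewrite in_sb_map.
- have hrem : rem_first (fun s => s_addr s == a) (sb p) = s1 ++ s2 := hsb'.
  rewrite hsb'; split; rewrite /= ?hrem //.
  + by rewrite map_cat.
  + by move: k5; rewrite hsb /sb_own !all_cat /= => /and3P[-> _ ->].
  + exact: (subseq_sorted ltn_trans hsub k6).
  + by apply/allP => k /(mem_subseq hsub) hk; move/allP: k7; apply.
  + move=> k hk; have hk' : k \in idxs (sb p) (rob p) \/ idx_bound p <= k.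
      by case: hk => [/(mem_subseq hsub)|]; [left|right].
    apply: (unspent_store (c := c)) (k8 _ hk') _ => //.
    rewrite et => -[ek]; case: hk => [hk|]; first by move: hnot; rewrite -ek hk.
    by rewrite leqNgt ek; move/allP: k7 => ->.
  + by move=> r; apply/leqW/k9.
  + exact: leqW.
  + by move=> t'; apply/leqW/k11.
  + have hbase b : bypass_sb b (rev (sb p)) =
        if has (fun s => s_addr s == b) s2 then bypass_sb b (rev s2)
        else if a == b then BypassHit v t else bypass_sb b (rev s1).
      by rewrite hsb -cat_rcons bypass_sb_cat rev_rcons.
    apply: (rob_ok_frame k12) => //=.
    * by move=> t1 t2; apply: not_newer_overwrite; [apply: (m_over Hm)|apply: (m_le Hm)].
    * move=> b; rewrite /base /= hbase bypass_sb_cat; case: ifP => _; first by left.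
      case: eqP => [eb|_]; last by left.
      subst b; right; exists v, t; rewrite /upd eqxx.
      split=> //; last by rewrite /seen_ts /= eqxx.
      exact/bypass_sb_top.
    (* The buffer held a store to [a], so a search for [a] could not reach memory. *)
    * move=> b v' t' k hb; have nb : b <> a.
        move=> eb; move: hb; rewrite /base /= hbase eb eqxx.
        by case: ifP => [h /bypass_sb_top|]; rewrite ?h.
      apply: (@readable_store_neq gts m wm over a v t i (tm t) Hm c) => //=.
      by move=> b1 x b2 ->; exists b1, b2.
- case: (M') => h1 h2 h3; split=> //.
  move=> u b v' t' q3 E; have [s3 [s4 [hs3 hn3]]] := h3 _ _ _ _ _ E.
  have nb : a <> b.
    move=> eb; move: hn; rewrite E map_cat mem_cat /= inE eb eqxx orbT //.
  rewrite hsb'; move: hs3; rewrite hsb => E3.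
  have [[_ [] //]|[z e1 e2]|[z e1 e2]] := split_cases E3.
    exists (s1 ++ z), s4; rewrite e2 -catA; split=> //.
    by move: hn3; rewrite e1 !has_cat /= => /norP[h /norP[_ h']]; rewrite negb_or h h'.
  by exists s3, (z ++ s2); rewrite e1 -catA.
Qed.

End Simulation.

(** * The simulation *)

Section Machines.

Context (Reg Addr PC : eqType) (Val : Type) (n : nat).
Variable (prog : 'I_n -> program Reg Addr PC Val).

(** Overwriting times describe the common memory and are shared by all processors, whereas each
    processor has its own [tm]. *)
Definition linked over (s : ooo_state Reg Addr PC Val n) (w : wstate Reg Addr PC Val n)
    (i : 'I_n) : Prop :=
  exists tm,
    core i (prog i) (w_gts w)
      (Ctx (o_mem s) (w_mem w) over tm (w_proc w i) (sb (o_proc s i))) (o_proc s i) /\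
    mrb_ok (o_mrb s i) (o_proc s i).

Definition sim s w : Prop :=
  exists over, mem_ok (w_gts w) (o_mem s) (w_mem w) over /\
    forall i, linked over s w i.

Lemma sim_init s0 : sim (ooo_init s0) (wmmd_init s0).
Proof.
exists (fun=> None); split.
  by split=> //= a b [].
move=> i; exists (fun=> 0); split; last by split=> // [[|? ?]|[|? ?]].
by split=> //= x e y; case: x.
Qed.

Lemma sim_step s w l s' : sim s w -> ooo_step prog s l s' ->
  (l = None /\ sim s' w) \/ exists2 w', wmmd_step prog w l w' & sim s' w'.
Proof.
move=> + R; case: R => {s l s'} [s i p' R|s i r p' R|s i x p' R
    |s i q1 k a q2 v t Eq Em|s i q1 a v t q2 Eq] [over [Hm H]].
- left; split=> //; exists over; split=> // j; rewrite /linked /= /upd.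
  case: eqP => [->|_]; last exact: H.
  have [tm [K M]] := H i; have [tm' [K' M']] := rule_silent K M R.
  by exists tm'; split=> //; apply: core_mk K'.
- left; split=> //; exists over; split=> // j; rewrite /linked /= /upd.
  case: eqP => [->|_]; last exact: H.
  have [tm [K M]] := H i; have [tm' [K' M']] := rule_call K M R.
  by exists tm'.
- right; have [tm [K M]] := H i.
  have [w' [tm' [hstep K' M']]] := rule_retire K M (m_val Hm) (m_over Hm) R.
  exists (WState (w_gts w) (w_mem w) (upd (w_proc w) i w')).
    exact: WStepExec hstep.
  exists over; split=> // j; rewrite /linked /= /upd.
  by case: eqP => [->|_]; [exists tm'|apply: H].
- left; split=> //; exists over; split=> // j; rewrite /linked /= /upd.
  case: eqP => [->|_]; last exact: H.
  have [tm [K M]] := H i; rewrite Eq in M.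
  have hov : over t = None by have := m_over Hm a; rewrite Em.
  have [tm' [K' M']] := resp_ld_ok K M Em hov (m_seen Hm i a).
  by exists tm'; split=> //; apply: core_mk K'.
- right; have [tm [K M]] := H i; rewrite Eq in M.
  have [s1 [s2 [hsb hno K' M' [[h1 h2] [k ek]]]]] := deq_own K M Hm.
  have hle : tm t <= w_gts w := k_tm K t.
  eexists; first exact: (WStepDeq prog hsb hno).
  exists (upd over (o_mem s a).2 (Some (w_gts w))); split; first exact: mem_ok_store.
  move=> j; rewrite /linked /= /upd; case: eqP => [->|ne]; first by exists tm.
  have [tmj [Kj Mj]] := H j; exists tmj; split=> //.
  by apply: core_deq_other => //; [move/esym|exists k].
Qed.

Lemma sim_exec s0 tr s : exec (ooo_step prog) (ooo_init s0) tr s ->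
  exists2 w, exec (wmmd_step prog) (wmmd_init s0) tr w & sim s w.
Proof.
elim=> [|tr' s1 l s2 _ [w hw hs] hstep].
  by exists (wmmd_init s0); [apply: ExecNil|apply: sim_init].
have [[-> hs']|[w' hw' hs']] := sim_step hs hstep.
  by exists w => //=; rewrite cats0.
by exists w' => //; apply: ExecStep hw hw'.
Qed.

End Machines.

Theorem theorem3 (Reg Addr PC : eqType) (Val : Type) (n : nat)
    (prog : 'I_n -> program Reg Addr PC Val)
    (s0 : init_state Reg Addr PC Val n)
    (b : behavior Reg Addr PC Val n) :
  ooo_ccm_behavior prog s0 b -> wmmd_behavior prog s0 b.
Proof.
case=> tr [s [hexec hsb hlog hmem]].
have [w hw [over [Hm H]]] := sim_exec hexec.
exists tr, w; split=> // [i|a]; last by rewrite hmem (m_val Hm).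
by have [tm [K _]] := H i; rewrite (k_wsb K) hsb.
Qed.
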